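(* Let $M$ be a $d\times d$ dilation matrix, $1\le q\le\infty$, $1/p+1/q=1$, $j\in\mathbb{N}$, $\alpha\ge 0$. Let $\{\varphi_j\}_{j\in\mathbb N}$ be a sequence of periodic functions in $L_p$ and $\{\widetilde\varphi_j\}_{j\in\mathbb N}$ a sequence of periodic distributions which satisfy the growth condition of order $N\ge 0$ for $\{\widetilde\varphi_j\}_j$, the Strang-Fix conditions of order $s>0$ for $\{\varphi_j\}_j$, the weak compatibility conditions of order $s$ for $\{\varphi_j\}_j$ and $\{\widetilde\varphi_j\}_j$, and the uniform boundedness condition for $\{\varphi_j\}_j$ (all as defined in the context), with $\{b_n\}_{n\in\mathbb{Z}^d}\in\ell_q^\alpha$. Suppose $f\in A_q^\gamma$, where $\gamma>\alpha$ and, moreover, $\gamma>N+d/p$ if $q\neq 1$, or $\gamma\ge N$ if $q=1$. Then $$\left\|f-Q_j(f,\varphi_j,\widetilde\varphi_j)\right\|_{A_q^\alpha}\le C\,\|M^{*j}\|^{2\alpha}\,\|M^{*-j}\|^{\min\{\gamma,s+\alpha\}}\,\|f\|_{A_q^\gamma},$$ where $C$ does not depend on $j$ and $f$. In addition, if $M$ is an isotropic matrix and $\lambda$ is its eigenvalue, then $$\left\|f-Q_j(f,\varphi_j,\widetilde\varphi_j)\right\|_{A_q^\alpha}\le C'\,|\lambda|^{-j\min\{\gamma-2\alpha,\,s-\alpha\}}\,\|f\|_{A_q^\gamma},$$ where $C'$ does not depend on $j$ and $f$.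
   Context: Notation. $\mathbb{T}^d=\mathbb{R}^d/\mathbb{Z}^d$, $L_p=L_p(\mathbb{T}^d)$, $(x,y)$ and $|x|$ are the Euclidean inner product and norm on $\mathbb{R}^d$, $\widehat f(k)$ is the $k$-th Fourier coefficient (with respect to $e^{2\pi i(k,x)}$), $\mathbf 0$ is the zero vector. A dilation matrix $M$ is an integer $d\times d$ matrix all of whose eigenvalues have absolute value greater than $1$; $m=|\det M|$; $M^*$ is the conjugate (adjoint) matrix, $M^{*j}=(M^* )^j$, $M^{*-j}=(M^* )^{-j}$; $\|\cdot\|$ is the operator norm on $\mathbb{R}^d$. $M$ is isotropic if it is similar to a diagonal matrix with diagonal entries $\lambda_1,\dots,\lambda_d$ satisfying $|\lambda_1|=\dots=|\lambda_d|$. For an integer matrix $A$, $D(A):=A[-1/2,1/2)^d\cap\mathbb{Z}^d$. Spaces. $\theta_\alpha(x)=(1+|x|^2)^{\alpha/2}$; $\ell_q^\alpha$ is the space of sequences $x=\{x_k\}_{k\in\mathbb{Z}^d}$ with $\|x\|_{\ell_q^\alpha}:=\|\{\theta_\alpha(k)x_k\}_k\|_{\ell_q(\mathbb{Z}^d)}<\infty$; $A_q^\alpha=\{f\in L_1:\{\widehat f(k)\}_k\in\ell_q^\alpha\}$ with $\|f\|_{A_q^\alpha}=\|\{\widehat f(k)\}_k\|_{\ell_q^\alpha}$. Operators. A periodic distribution is a continuous linear functional on $C^\infty(\mathbb{T}^d)$; it is determined by its Fourier coefficients, which grow at most polynomially. For a periodic distribution $\widetilde\varphi_j$ and a function $f$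 for which the series converges, set $$\langle f,\widetilde\varphi_j(\cdot-M^{-j}k)\rangle:=\sum_{l\in\mathbb{Z}^d}\widehat f(l)\,\overline{\widehat{\widetilde\varphi_j}(l)}\,e^{2\pi i(k,M^{*-j}l)},$$ and $$Q_j(f,\varphi_j,\widetilde\varphi_j)=\frac1{m^j}\sum_{k\in D(M^j)}\langle f,\widetilde\varphi_j(\cdot-M^{-j}k)\rangle\,\varphi_j(\cdot-M^{-j}k).$$ Conditions (constants $C_{\widetilde\varphi},C_\varphi$ and nonnegative numbers $b_n$, $n\in\mathbb{Z}^d$, do not depend on $j$). (1) Growth of order $N$ for $\{\widetilde\varphi_j\}_j$: for all $j\in\mathbb{N}$, $|\widehat{\widetilde\varphi_j}(k)|\le C_{\widetilde\varphi}|M^{*-j}k|^N$ for all $k\in\mathbb{Z}^d\setminus D(M^{*j})$, and $\max_{k\in D(M^{*j})}|\widehat{\widetilde\varphi_j}(k)|\le C_{\widetilde\varphi}$. (2) Strang-Fix conditions of order $s$ for $\{\varphi_j\}_j$: $|\widehat{\varphi_j}(M^{*j}n+r)|\le b_n|M^{*-j}r|^s$ for all $n\in\mathbb{Z}^d\setminus\{\mathbf 0\}$, $r\in D(M^{*j})$, $j\in\mathbb{N}$. (3) Weak compatibility of order $s$: $|1-\widehat{\varphi_j}(r)\overline{\widehat{\widetilde\varphi_j}(r)}|\le b_{\mathbf 0}|M^{*-j}r|^s$ for all $r\in D(M^{*j})$, $j\in\mathbb{N}$. (4) Uniform boundedness: $\max_{k\in D(M^{*j})}|\widehat{\varphi_j}(k)|\le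 C_\varphi$ for all $j\in\mathbb{N}$. *)

(* Defs.v *)
From HB Require Import structures.
From mathcomp Require Import all_boot all_order all_algebra.
From mathcomp Require Import complex.
From mathcomp Require Import all_classical all_reals all_analysis.

Set Implicit Arguments.
Unset Strict Implicit.
Unset Printing Implicit Defensive.
Import Order.TTheory GRing.Theory Num.Theory.
Import numFieldNormedType.Exports.
Import ComplexField.Normc.

Local Open Scope classical_set_scope.
Local Open Scope ring_scope.

(* Functions on the torus R^d/Z^d are 1-periodic functions 'cV[R]_d -> R[i];
   a frequency k in Z^d is a column of integers. *)

Section Euclidean.
Context {R : realType} {d : nat}.
Implicit Types (x y : 'cV[R]_d) (A : 'M[R]_d).

Definition dotp x y : R := \sum_(i < d) x i 0 * y i 0.

Definition enorm x : R := Num.sqrt (dotp x x).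

Definition opnorm A : R :=
  sup [set enorm (A *m x) | x in [set x : 'cV[R]_d | enorm x <= 1]].

Definition zvec (k : 'cV[int]_d) : 'cV[R]_d := map_mx intr k.

Definition zmat (A : 'M[int]_d) : 'M[R]_d := map_mx intr A.

(* e^{2 pi i t} *)
Definition expi (t : R) : R[i] := (cos (2 * pi * t) +i* sin (2 * pi * t))%C.

Definition torus_char (k : 'cV[int]_d) (x : 'cV[R]_d) : R[i] :=
  expi (dotp (zvec k) x).

Definition torus_periodic (f : 'cV[R]_d -> R[i]) :=
  forall (x : 'cV[R]_d) (k : 'cV[int]_d), f (x + zvec k) = f x.

End Euclidean.

Section DilationMatrix.
Context (R : realType) {d : nat}.
Implicit Types M A : 'M[int]_d.

Definition cmat M : 'M[R[i]]_d := map_mx intr M.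

Definition dilation M :=
  forall a : R[i], eigenvalue (cmat M) a -> 1 < normc a.

Definition isotropic M :=
  exists (P : 'M[R[i]]_d) (lam : 'rV[R[i]]_d),
    [/\ P \in unitmx,
        cmat M = P *m diag_mx lam *m invmx P &
        forall i k, normc (lam 0 i) = normc (lam 0 k)].

(* D(A) = A [-1/2, 1/2)^d \cap Z^d *)
Definition digits A : set 'cV[int]_d :=
  [set k | exists2 x : 'cV[R]_d,
     (forall i, - 2^-1 <= x i 0 < 2^-1) & zvec k = zmat A *m x].

(* (M^* )^j and (M^* )^{-j} as real matrices *)
Definition adjpow M (j : nat) : 'M[R]_d := zmat (M^T ^+ j).

Definition adjpowV M (j : nat) : 'M[R]_d := invmx (adjpow M j).

End DilationMatrix.

(* Haar probability measure of R^d/Z^d, as the d-fold product of the Lebesgue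
   measure on [0, 1). *)
Section TorusMeasure.
Context {R : realType}.

Definition circle_measure : set (measurableTypeR R) -> \bar R :=
  mrestr lebesgue_measure (measurable_itv `[(0:R), 1[).

HB.instance Definition _ := Measure.on circle_measure.

Lemma circle_measureT : circle_measure setT = 1%E.
Proof.
rewrite /circle_measure /mrestr setTI lebesgue_measure_itv/= lte_fin ltr01.
by rewrite oppr0 adde0.
Qed.

HB.instance Definition _ :=
  Measure_isProbability.Build _ _ _ circle_measure circle_measureT.

Definition tcons n (x : measurableTypeR R * n.-tuple (measurableTypeR R)) :
    n.+1.-tuple (measurableTypeR R) :=
  [tuple of x.1 :: x.2].

Lemma measurable_tcons n : measurable_fun setT (@tcons n).
Proof. by apply: measurable_cons. Qed.

HB.instance Definition _ n :=
  isMeasurableFun.Build _ _ _ _ (@tcons n) (@measurable_tcons n).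

Fixpoint torus_measure (n : nat) : 
    probability (n.-tuple (measurableTypeR R)) R :=
  match n with
  | 0%N => \d_([tuple] : 0.-tuple (measurableTypeR R))
  | n'.+1 => distribution (circle_measure \x torus_measure n')%E (@tcons n')
  end.

End TorusMeasure.

Section FunctionSpaces.
Context {R : realType} {d : nat}.
Implicit Types f : 'cV[R]_d -> R[i].

Definition colt (t : d.-tuple (measurableTypeR R)) : 'cV[R]_d := \col_i tnth t i.

Definition torus_integral f : R[i] :=
  ((\int[torus_measure d]_t complex.Re (f (colt t))) +i*
   (\int[torus_measure d]_t complex.Im (f (colt t))))%C.

Definition Lp (p : \bar R) f :=
  [/\ torus_periodic f,
      measurable_fun setT (fun t => complex.Re (f (colt t))),
      measurable_fun setT (fun t => complex.Im (f (colt t))) &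
      finite_norm (torus_measure d) p (fun t => normc (f (colt t)))].

Definition fourier f (k : 'cV[int]_d) : R[i] :=
  torus_integral (fun x => f x * torus_char (- k) x).

Definition theta (alpha : R) (k : 'cV[int]_d) : R :=
  (1 + enorm (zvec k) ^+ 2) `^ (alpha / 2).

Definition wlnorm (q : \bar R) (alpha : R) (x : 'cV[int]_d -> R[i]) : \bar R :=
  match q with
  | r%:E => ((\esum_(k in [set: 'cV[int]_d])
                ((theta alpha k * normc (x k)) `^ r)%:E) `^ r^-1)%E
  | +oo%E => ereal_sup (range (fun k => (theta alpha k * normc (x k))%:E))
  | -oo%E => 0%E (* unused: q >= 1 throughout *)
  end.

Definition Anorm q alpha f : \bar R := wlnorm q alpha (fourier f).

Definition Aspace q alpha f := Lp 1 f /\ (Anorm q alpha f < +oo)%E.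

End FunctionSpaces.

Section PeriodicDistributions.
Context {R : realType} {d : nat}.
Implicit Types (u : 'cV[R]_d -> R[i]) (g : 'cV[R]_d -> R).

Definition basis_vec (i : 'I_d) : 'cV[R]_d := delta_mx i 0.

Fixpoint partials (s : seq 'I_d) g : 'cV[R]_d -> R :=
  if s is i :: s' then 'D_(basis_vec i) (partials s' g) else g.

Definition cpartials (s : seq 'I_d) u (x : 'cV[R]_d) : R[i] :=
  (partials s (fun y => complex.Re (u y)) x +i* partials s (fun y => complex.Im (u y)) x)%C.

Definition smooth g :=
  forall s : seq 'I_d, continuous (partials s g) /\
    forall (i : 'I_d) (x : 'cV[R]_d), derivable (partials s g) x (basis_vec i).

(* C^\infty of the torus *)
Definition test_function u :=
  [/\ torus_periodic u, smooth (fun x => complex.Re (u x)) & smooth (fun x => complex.Im (u x))].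

(* The topology of C^\infty of the torus is metrizable; a sequence converges iff
   all its partial derivatives converge uniformly. *)
Definition test_cvg (u_ : nat -> 'cV[R]_d -> R[i]) u :=
  forall (s : seq 'I_d) (e : R), 0 < e -> \forall n \near \oo,
    forall x, normc (cpartials s (u_ n) x - cpartials s u x) <= e.

Record periodic_distribution := PeriodicDistribution {
  dist_fun :> ('cV[R]_d -> R[i]) -> R[i];
  dist_linear : forall (a : R[i]) u v, test_function u -> test_function v ->
    dist_fun (fun x => a * u x + v x) = a * dist_fun u + dist_fun v;
  dist_continuous : forall (u_ : nat -> 'cV[R]_d -> R[i]) u,
    (forall n, test_function (u_ n)) -> test_function u -> test_cvg u_ u ->
    normc (dist_fun (u_ n) - dist_fun u) @[n --> \oo] --> (0 : R)
}.

Definition dfourier (T : periodic_distribution) (k : 'cV[int]_d) : R[i] :=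
  T (torus_char (- k)).

End PeriodicDistributions.
Arguments periodic_distribution : clear implicits.

Section Series.
Context {R : realType} {T : choiceType}.

Definition csummable (x : T -> R[i]) :=
  summable [set: T] (fun l => (normc (x l))%:E).

Definition rsum (x : T -> R) : R :=
  fine (\esum_(l in [set: T]) ((EFin \o x)^\+ l)
        - \esum_(l in [set: T]) ((EFin \o x)^\- l))%E.

(* sum of an absolutely convergent family *)
Definition csum (x : T -> R[i]) : R[i] :=
  (rsum (fun l => complex.Re (x l)) +i* rsum (fun l => complex.Im (x l)))%C.

End Series.

Section QuasiProjection.
Context {R : realType} {d : nat} (M : 'M[int]_d).
Implicit Types (f : 'cV[R]_d -> R[i]).

Definition pairing_term (j : nat) f (tphi : periodic_distribution R d)
    (k l : 'cV[int]_d) : R[i] :=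
  fourier f l * (dfourier tphi l)^*%C *
    expi (dotp (zvec k) (adjpowV R M j *m zvec l)).

(* < f, tphi (. - M^{-j} k) > *)
Definition pairing j f tphi k : R[i] := csum (pairing_term j f tphi k).

Definition quasi_projection (j : nat) f (phi : 'cV[R]_d -> R[i])
    (tphi : periodic_distribution R d) (x : 'cV[R]_d) : R[i] :=
  (`|\det M|%N ^ j)%:R^-1 *
  \sum_(k \in digits R (M ^+ j))
     pairing j f tphi k * phi (x - invmx (zmat (M ^+ j)) *m zvec k).

Definition quasi_error j f phi tphi (x : 'cV[R]_d) : R[i] :=
  f x - quasi_projection j f phi tphi x.

End QuasiProjection.

(* The levels j are the positive integers. *)
Section Conditions.
Context {R : realType} {d : nat} (M : 'M[int]_d).
Variables (phi : nat -> 'cV[R]_d -> R[i]) (tphi : nat -> periodic_distribution R d).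
Variable b : 'cV[int]_d -> R.

Definition growth_condition (N Ctphi : R) :=
  forall j, (0 < j)%N ->
    (forall k, ~ digits R (M^T ^+ j) k ->
       normc (dfourier (tphi j) k) <= Ctphi * enorm (adjpowV R M j *m zvec k) `^ N)
    /\ (forall k, digits R (M^T ^+ j) k -> normc (dfourier (tphi j) k) <= Ctphi).

Definition strang_fix (s : R) :=
  forall j, (0 < j)%N -> forall n r : 'cV[int]_d, n != 0 ->
    digits R (M^T ^+ j) r ->
    normc (fourier (phi j) (M^T ^+ j *m n + r))
      <= b n * enorm (adjpowV R M j *m zvec r) `^ s.

Definition weak_compatibility (s : R) :=
  forall j, (0 < j)%N -> forall r : 'cV[int]_d, digits R (M^T ^+ j) r ->
    normc (1 - fourier (phi j) r * (dfourier (tphi j) r)^*%C)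
      <= b 0 * enorm (adjpowV R M j *m zvec r) `^ s.

Definition uniform_bound (Cphi : R) :=
  forall j, (0 < j)%N -> forall k : 'cV[int]_d, digits R (M^T ^+ j) k ->
    normc (fourier (phi j) k) <= Cphi.

End Conditions.

(* Main.v *)
(* Write A = M^*j.  Every frequency is uniquely l = A n + r with r in D(A), and
   orthogonality of the characters of Z^d / M^j Z^d shows that the l-th Fourier
   coefficient of Q_j f is that of phi_j times the aliased sum over nu of
   c(A nu + r), where c(l) is the coefficient of f times the conjugate of that of
   tphi_j.  Put F(l) = theta_gamma(l) |f^(l)| and H(r) = || F(A . + r) ||_q.  The
   growth condition and Hoelder's inequality bound the terms nu <> 0 of the
   aliased sum by a constant times ||A^-1||^gamma H(r), and the Strang-Fix,
   compatibility and boundedness conditions then give, pointwise,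
     theta_alpha(l) |f^(l) - (Q_j f)^(l)| <= C rate (F(l) + B(n) H(r)),
   where rate = ||A||^(2 alpha) ||A^-1||^min(gamma, s + alpha), and B(n) is
   theta_alpha(n) b_n, increased by 1 at n = 0.  Taking l_q norms over the pairs
   (n, r) gives the estimate, because B is in l_q and || H ||_q = || F ||_q.
   Uniformity in j only uses that ||A^-1|| stays bounded and that ||A|| >= 1. *)

From HB Require Import structures.
Require Import Defs.
From mathcomp Require Import all_boot all_order all_algebra.
From mathcomp Require Import complex ring lra.
From mathcomp Require Import all_classical all_reals all_analysis.
From mathcomp Require Import measurable_realfun.

Set Implicit Arguments.
Unset Strict Implicit.
Unset Printing Implicit Defensive.
Import Order.TTheory GRing.Theory Num.Theory.
Import numFieldNormedType.Exports.
Import ComplexField.Normc.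
Local Open Scope classical_set_scope.
Local Open Scope ring_scope.

(** * Norms and matrices *)

(** Origin of the exponents. Comparing theta_alpha(A n + r) with theta_alpha(n) costs one factor
    ||A||^alpha. Smoothness and the order s provide the decay ||A^-1||^mu with mu = min(gamma -
    alpha, s); as 1 <= ||A|| ||A^-1||, this is at most ||A||^alpha ||A^-1||^(mu + alpha), which
    produces the second factor ||A||^alpha and the exponent min(gamma, s + alpha). The lower bound
    on gamma comes from aliasing. For l = A n + r with n <> 0, growth of order N against smoothness
    gamma leaves the weight |A^-1 l|^(N - gamma), at most a constant times |n|^(N - gamma). Its p-th
    power is summable over n <> 0 when (gamma - N) p > d; for q = 1 it only has to be bounded, hence
    gamma >= N. The aliasing error at A n + r is a function of r that involves the whole coset, so
    it is measured by a norm over that coset; passing to these norms loses nothing because the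
    cosets partition Z^d. *)

Section EuclideanNorm.
Context {R : realType} {d : nat}.
Implicit Types (x y : 'cV[R]_d) (A : 'M[R]_d).

Lemma enorm_ge0 x : 0 <= enorm x.
Proof. exact: sqrtr_ge0. Qed.

Lemma sqr_enorm x : enorm x ^+ 2 = \sum_i x i 0 ^+ 2.
Proof.
rewrite /enorm /dotp sqr_sqrtr; last by apply: sumr_ge0 => i _; rewrite -expr2 sqr_ge0.
by apply: eq_bigr => i _; rewrite expr2.
Qed.

Lemma enorm_le x c : 0 <= c -> \sum_i x i 0 ^+ 2 <= c ^+ 2 -> enorm x <= c.
Proof. by move=> c0; rewrite -sqr_enorm ler_pXn2r// nnegrE// enorm_ge0. Qed.

Lemma ler_coord_enorm x i : `|x i 0| <= enorm x.
Proof.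
rewrite -(@ler_pXn2r _ 2)// ?nnegrE ?enorm_ge0// sqr_enorm real_normK ?num_real//.
by rewrite (bigD1 i)//= lerDl sumr_ge0// => j _; exact: sqr_ge0.
Qed.

Lemma enormZ c x : enorm (c *: x) = `|c| * enorm x.
Proof.
rewrite /enorm -sqrtr_sqr -sqrtrM ?sqr_ge0//; congr Num.sqrt.
by rewrite /dotp mulr_sumr; apply: eq_bigr => i _; rewrite !mxE; ring.
Qed.

Lemma enorm0 : enorm (0 : 'cV[R]_d) = 0.
Proof. by rewrite -(scale0r 0) enormZ normr0 mul0r. Qed.

Lemma enorm_gt0 x : x != 0 -> 0 < enorm x.
Proof.
rewrite lt_neqAle enorm_ge0 andbT eq_sym; apply: contra_neq => x0.
apply/colP => i; rewrite mxE.
by have := ler_coord_enorm x i; rewrite -x0 normr_le0 => /eqP ->.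
Qed.

(** The coordinatewise bound (x + y)^2 <= 2 x^2 + 2 y^2 suffices, since a factor 2 only enters the
    final constant. *)
Lemma enormD_le x y : enorm (x + y) <= 2 * (enorm x + enorm y).
Proof.
have x0 := enorm_ge0 x; have y0 := enorm_ge0 y.
apply: enorm_le; first lra.
apply: (@le_trans _ _ (2 * enorm x ^+ 2 + 2 * enorm y ^+ 2)); last nra.
rewrite !sqr_enorm !mulr_sumr -big_split/=; apply: ler_sum => i _; rewrite !mxE.
by have := sqr_ge0 (x i 0 - y i 0); nra.
Qed.

Lemma enorm_le_coord x c : 0 <= c -> (forall i, `|x i 0| <= c) ->
  enorm x <= c * d%:R.
Proof.
move=> c0 xc; apply: enorm_le; first by rewrite mulr_ge0.
apply: (@le_trans _ _ (\sum_(i < d) c ^+ 2)).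
  by apply: ler_sum => i _; rewrite -real_normK ?num_real// ler_pXn2r ?nnegrE.
rewrite sumr_const card_ord exprMn -[leLHS]mulr_natr ler_wpM2l ?sqr_ge0//.
by rewrite -natrX ler_nat; case: (d) => // n; rewrite leq_pmull.
Qed.

(** This crude bound serves twice: it makes the set defining [opnorm] bounded, and it turns
    entrywise bounds on matrix powers into norm bounds. *)
Lemma enorm_mulmx_le A x c : 0 <= c -> (forall i j, `|A i j| <= c) ->
  enorm (A *m x) <= c * (d * d)%:R * enorm x.
Proof.
move=> c0 Ac; rewrite natrM mulrA -mulrA (mulrC d%:R) mulrA.
apply: (le_trans (@enorm_le_coord _ (c * d%:R * enorm x) _ _)).
- by rewrite !mulr_ge0 ?enorm_ge0.
- move=> i; rewrite mxE (le_trans (ler_norm_sum _ _ _))//.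
  apply: (@le_trans _ _ (\sum_(j < d) c * enorm x)).
    apply: ler_sum => j _; rewrite normrM.
    by rewrite ler_pM// ler_coord_enorm.
  by rewrite sumr_const card_ord -[leLHS]mulr_natl mulrA (mulrC _%:R).
- lra.
Qed.

(** The real [sup] takes a default value on sets without a supremum, so the estimates on [opnorm]
    rest on this fact. *)
Lemma has_sup_opnorm A :
  has_sup [set enorm (A *m x) | x in [set x : 'cV[R]_d | enorm x <= 1]].
Proof.
split; first by exists (enorm (A *m 0)), 0; rewrite //= enorm0.
pose c := \sum_(ij : 'I_d * 'I_d) `|A ij.1 ij.2|.
exists (c * (d * d)%:R) => _ [x /= x1 <-].
apply: (le_trans (@enorm_mulmx_le A x c _ _)).
- exact: sumr_ge0.
- by move=> i j; rewrite /c (bigD1 (i, j))//= lerDl sumr_ge0.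
- by rewrite -[leRHS]mulr1 ler_wpM2l// mulr_ge0// sumr_ge0.
Qed.

Lemma enorm_mulmx A x : enorm (A *m x) <= opnorm A * enorm x.
Proof.
have [->|x0] := eqVneq x 0; first by rewrite mulmx0 enorm0 mulr0.
have {}x0 := enorm_gt0 x0.
rewrite -ler_pdivrMr// mulrC -[X in X * _]gtr0_norm ?invr_gt0// -enormZ scalemxAr.
apply: (sup_ubound (has_sup_opnorm A).2); exists ((enorm x)^-1 *: x) => //=.
by rewrite enormZ gtr0_norm ?invr_gt0// mulVf// gt_eqF.
Qed.

Lemma opnorm_ge0 A : 0 <= opnorm A.
Proof.
apply: (sup_ubound (has_sup_opnorm A).2).
by exists 0; rewrite /= ?mulmx0 ?enorm0.
Qed.

Lemma opnorm_le_entries A c : 0 <= c -> (forall i j, `|A i j| <= c) ->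
  opnorm A <= c * (d * d)%:R.
Proof.
move=> c0 Ac; apply: ge_sup; first exact: (has_sup_opnorm A).1.
move=> _ [x /= x1 <-]; apply: (le_trans (@enorm_mulmx_le A x c c0 Ac)).
by rewrite -[leRHS]mulr1 ler_wpM2l// mulr_ge0.
Qed.

Lemma enorm_delta (i : 'I_d) : enorm (delta_mx i 0 : 'cV[R]_d) = 1.
Proof.
rewrite /enorm /dotp (bigD1 i)//= big1 => [|j ji].
  by rewrite !mxE !eqxx mulr1 addr0 sqrtr1.
by rewrite !mxE (negPf ji) mulr0.
Qed.

(** Write a unit vector e as A (A^-1 e); in dimension 0 there is no such vector and both norms are
    0. *)
Lemma opnorm_mulV_ge1 A : (0 < d)%N -> A \in unitmx ->
  1 <= opnorm A * opnorm (invmx A).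
Proof.
move=> d0 uA; pose e : 'cV[R]_d := delta_mx (Ordinal d0) 0.
have /esym-> : enorm (A *m (invmx A *m e)) = 1 by rewrite mulKVmx// enorm_delta.
apply: (le_trans (enorm_mulmx _ _)); rewrite ler_wpM2l ?opnorm_ge0//.
by apply: (le_trans (enorm_mulmx _ _)); rewrite enorm_delta mulr1.
Qed.

End EuclideanNorm.

Section IntegerVectors.
Context {R : realType} {d : nat}.
Implicit Types k l : 'cV[int]_d.

Lemma zvec_inj : injective (@zvec R d).
Proof.
move=> k l /colP kl; apply/colP => i; apply: (@intr_inj R).
by have := kl i; rewrite !mxE.
Qed.

Lemma zvec0 : zvec 0 = 0 :> 'cV[R]_d.
Proof. by apply/colP => i; rewrite !mxE. Qed.

Lemma zvecD k l : zvec (k + l) = zvec k + zvec l :> 'cV[R]_d.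
Proof. by apply/colP => i; rewrite !mxE intrD. Qed.

Lemma zvecN k : zvec (- k) = - zvec k :> 'cV[R]_d.
Proof. by apply/colP => i; rewrite !mxE mulrNz. Qed.

Lemma zvec_mulmx (A : 'M[int]_d) k : zvec (A *m k) = zmat A *m zvec k :> 'cV[R]_d.
Proof. exact: map_mxM. Qed.

Lemma enorm_zvec_ge1 k : k != 0 -> 1 <= enorm (zvec k : 'cV[R]_d).
Proof.
move=> k0; have [i ki] : exists i, k i 0 != 0.
  apply/existsP; apply: contraNT k0 => /existsPn k0.
  by apply/eqP/colP => i; rewrite mxE; have /negbNE/eqP := k0 i.
apply: le_trans (ler_coord_enorm _ i); rewrite mxE norm_intr_ge1 ?intr_int//.
by rewrite intr_eq0.
Qed.

Lemma unitmx_zmat (A : 'M[int]_d) : \det A != 0 -> (zmat A : 'M[R]_d) \in unitmx.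
Proof. by rewrite unitmxE det_map_mx unitfE intr_eq0. Qed.

(** A nonsingular integer matrix sends a basis vector to a nonzero integer vector, whose norm is at
    least 1. *)
Lemma opnorm_zmat_ge1 (A : 'M[int]_d) : (0 < d)%N -> \det A != 0 ->
  1 <= opnorm (zmat A : 'M[R]_d).
Proof.
move=> d0 dA; pose e : 'cV[int]_d := delta_mx (Ordinal d0) 0.
have ze : zvec e = delta_mx (Ordinal d0) 0 :> 'cV[R]_d by exact: map_delta_mx.
apply: (@le_trans _ _ (enorm (zvec (A *m e) : 'cV[R]_d))).
  apply: enorm_zvec_ge1; apply/eqP => Ae0.
  have := unitmx_zmat dA => uA; have := enorm_delta (R := R) (Ordinal d0).
  rewrite -ze -(mulKmx uA (zvec e)) -zvec_mulmx Ae0 zvec0 mulmx0 enorm0.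
  by move/eqP; rewrite eq_sym oner_eq0.
by rewrite zvec_mulmx ze (le_trans (enorm_mulmx _ _))// enorm_delta mulr1.
Qed.

End IntegerVectors.

(** * Digits and characters *)

Section Expi.
Context {R : realType}.
Implicit Types t u : R.

Lemma expiD t u : expi (t + u) = expi t * expi u.
Proof.
rewrite /expi mulrDr cosD sinD; apply/eqP.
by rewrite eq_complex/= eqxx/= addrC (mulrC (sin _)).
Qed.

Lemma expi0 : expi (0 : R) = 1.
Proof. by rewrite /expi mulr0 cos0 sin0. Qed.

Lemma normc_expi t : normc (expi t) = 1.
Proof. by rewrite /expi /= cos2Dsin2 sqrtr1. Qed.

Lemma expi_neq0 t : expi t != 0.
Proof.
apply/eqP => e0; have := normc_expi t.
by rewrite e0 normc0 => /esym/eqP; rewrite oner_eq0.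
Qed.

Lemma expi1 : expi (1 : R) = 1.
Proof. by rewrite /expi mulr1 mulrC mulr_natr cos2pi sin2pi. Qed.

Lemma expi_nat n : expi (n%:R : R) = 1.
Proof. by elim: n => [|n ih]; rewrite ?expi0// -addn1 natrD expiD ih expi1 mulr1. Qed.

Lemma expiN t : expi (- t) = (expi t)^-1.
Proof. by apply: (mulIf (expi_neq0 t)); rewrite -expiD addNr expi0 mulVf// expi_neq0. Qed.

Lemma expi_int (z : int) : expi (z%:~R : R) = 1.
Proof.
case: z => n; first exact: expi_nat.
by rewrite NegzE mulrNz expiN -pmulrn expi_nat invr1.
Qed.

Lemma expi_eq1 t : expi t = 1 -> exists z : int, t = z%:~R.
Proof.
move=> t1; exists (Num.floor t); set z := Num.floor t; pose u := t - z%:~R.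
have /andP[u0 u1] : 0 <= u < 1.
  have := floor_eq t z; rewrite eqxx intrD => /esym.
  by rewrite /u subr_ge0 ltrBlDl.
(* With cos (2 pi u) = 1 the double angle formula gives sin (pi u) = 0, which is impossible for 0 <
   u < 1. *)
have : expi u = 1 by rewrite expiD t1 -mulrNz expi_int mulr1.
rewrite /expi => -[]; rewrite -mulrA mulr_natl cos_mulr2n => cu _.
suff : u = 0 by move/eqP; rewrite subr_eq0 => /eqP.
apply/eqP; apply: contraT => u_neq0.
have : 0 < sin (pi * u).
  apply: sin_gt0_pi; rewrite mulr_gt0 ?pi_gt0 ?lt0r ?u_neq0//=.
  by rewrite gtr_pMr ?pi_gt0.
by have := cos2Dsin2 (pi * u); nra.
Qed.

End Expi.

Section DigitRepresentation.
Context (R : realType) {d : nat}.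
Variable A : 'M[int]_d.
Hypothesis detA : \det A != 0.
Implicit Types k l n r : 'cV[int]_d.

Let uA : (zmat A : 'M[R]_d) \in unitmx := unitmx_zmat detA.

(** Rounding x to floor (x + 1/2) picks the lattice point n with x - n in the half-open cube of the
    definition of [digits]; this is why D(A) represents each class modulo A Z^d exactly once. *)
Definition digit_quot l : 'cV[int]_d :=
  \col_i Num.floor ((invmx (zmat A) *m zvec l : 'cV[R]_d) i 0 + 2^-1).

Definition digit_rep l : 'cV[int]_d := l - A *m digit_quot l.

Lemma digit_eq l : l = A *m digit_quot l + digit_rep l.
Proof. by rewrite addrC subrK. Qed.

Lemma digitsP k : digits R A k <->
  forall i, - 2^-1 <= (invmx (zmat A) *m zvec k : 'cV[R]_d) i 0 < 2^-1.
Proof.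
split=> [[x xP ->] i|kP]; first by rewrite mulKmx.
by exists (invmx (zmat A) *m zvec k) => //; rewrite mulKVmx.
Qed.

Lemma digits0 : digits R A 0.
Proof. by apply/digitsP => i; rewrite zvec0 mulmx0 mxE; lra. Qed.

Lemma digit_rep_digits l : digits R A (digit_rep l).
Proof.
apply/digitsP => i; rewrite zvecD zvecN zvec_mulmx mulmxDr mulmxN mulKmx// !mxE.
set x := \sum_j _; have := floor_eq (x + 2^-1) (Num.floor (x + 2^-1)).
by rewrite eqxx intrD => /esym; lra.
Qed.

Lemma digit_quotP n r : digits R A r -> digit_quot (A *m n + r) = n.
Proof.
move=> /digitsP rP; apply/colP => i; rewrite mxE zvecD zvec_mulmx mulmxDr mulKmx//.
by apply/eqP; rewrite floor_eq intrD; have := rP i; rewrite !mxE; lra.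
Qed.

Lemma digit_repP n r : digits R A r -> digit_rep (A *m n + r) = r.
Proof. by move=> rP; rewrite /digit_rep digit_quotP// addrC addKr. Qed.

Lemma digit_rep_id r : digits R A r -> digit_rep r = r.
Proof. by move=> /(digit_repP 0); rewrite mulmx0 add0r. Qed.

Lemma digit_quot_id r : digits R A r -> digit_quot r = 0.
Proof. by move=> /(digit_quotP 0); rewrite mulmx0 add0r. Qed.

Lemma digit_repD l n : digit_rep (l + A *m n) = digit_rep l.
Proof.
rewrite {1}(digit_eq l) addrAC -mulmxDr digit_repP//; exact: digit_rep_digits.
Qed.

Lemma digit_rep_eqP k l :
  digit_rep k = digit_rep l <-> exists n, k = l + A *m n.
Proof.
split=> [kl|[n ->]]; last by rewrite digit_repD.
exists (digit_quot k - digit_quot l).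
by rewrite {1}(digit_eq k) kl mulmxBr /digit_rep addrCA.
Qed.

Lemma digits_add_bij :
  set_bij (digits R A `*` [set: 'cV[int]_d]) setT (fun rn => A *m rn.2 + rn.1).
Proof.
split=> [//||l _].
  move=> [r n] [r' n'] /set_mem[/= rP _] /set_mem[/= r'P _] e.
  have := digit_repP n rP; have := digit_quotP n rP.
  by rewrite e digit_quotP// digit_repP// => -> ->.
exists (digit_rep l, digit_quot l); first by split=> //; exact: digit_rep_digits.
by rewrite -digit_eq.
Qed.

(** Translation permutes the classes modulo A Z^d; reducing again makes it a permutation of the
    representatives, as the orthogonality of characters requires. *)
Lemma digit_translation_bij k : set_bij (digits R A) (digits R A)
  (fun l => digit_rep (l + k)).
Proof.
split=> [l _||l lP]; first exact: digit_rep_digits.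
  move=> l l' /set_mem lP /set_mem l'P /digit_rep_eqP[n e].
  rewrite -(digit_rep_id lP) -(digit_rep_id l'P); apply/digit_rep_eqP; exists n.
  by move: e; rewrite addrAC => /addIr.
exists (digit_rep (l - k)); first exact: digit_rep_digits.
rewrite -[RHS]digit_rep_id//; apply/digit_rep_eqP; exists (- digit_quot (l - k)).
by rewrite /digit_rep mulmxN addrAC subrK.
Qed.

End DigitRepresentation.

(** * Number of digits and orthogonality of characters *)

Section DigitCount.
Context (R : realType) {d : nat}.
Variable A : 'M[int]_d.
Hypothesis detA : \det A != 0.

(* The Smith normal form A = L D S identifies Z^d / A Z^d with the product of the
   Z / D_ii, so D(A) is enumerated by the residues modulo the D_ii. *)
Lemma digits_enumeration : exists (T : finType) (g : T -> 'cV[int]_d),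
  set_bij [set: T] (digits R A) g /\ #|T| = `|\det A|%N.
Proof.
have [L uL [S uS [s _ AE]]] := int_Smith_normal_form A.
pose D : 'M[int]_d := \matrix_(i, j) (s`_i *+ (i == j :> nat)).
have {}AE : A = L *m D *m S by [].
pose a (i : 'I_d) := absz s`_i.
have DE : D = diag_mx (\row_i s`_i).
  by apply/matrixP => i j; rewrite !mxE.
have detAE : `|\det A|%N = (\prod_i a i)%N.
  have unit1 (U : 'M[int]_d) : U \in unitmx -> `|\det U|%N = 1%N.
    rewrite unitmxE => /mulVr /(congr1 absz) /eqP.
    by rewrite abszM muln_eq1 => /andP[_ /eqP].
  rewrite AE !det_mulmx !abszM (unit1 L)// (unit1 S)// mul1n muln1 DE det_diag.
  elim/big_rec2: _ => // i x y _ <-; by rewrite abszM mxE.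
(* Nonsingularity excludes a zero invariant factor, so each set of residues is finite and
   nonempty. *)
have a_gt0 i : (0 < a i)%N.
  have := detA; rewrite -absz_eq0 detAE (bigD1 i)//= muln_eq0 negb_or lt0n.
  by case/andP.
have s_neq0 i : s`_(i : 'I_d) != 0 by rewrite -absz_gt0; exact: a_gt0.
pose T := {dffun forall i : 'I_d, 'I_(a i)}.
pose v (f : T) : 'cV[int]_d := \col_i (f i : nat)%:Z.
pose g (f : T) := digit_rep R A (L *m v f).
exists T, g; split; last first.
  rewrite card_dep_ffun foldrE big_image/= detAE.
  by apply: eq_bigr => i _; rewrite card_ord.
have mulD w i : (D *m w : 'cV[int]_d) i 0 = s`_i * w i 0.
  by rewrite DE mul_diag_mx !mxE.
split=> [f _|f f' _ _|k kP].
- exact: digit_rep_digits.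
(* Applying L^-1 to the congruence leaves v f = v f' + D (S n), a congruence modulo s_i in each
   coordinate. *)
- move=> /(digit_rep_eqP _ detA)[n]; rewrite AE -!mulmxA -mulmxDr.
  move=> /(congr1 (mulmx (invmx L))); rewrite !mulKmx// => vE.
  apply/ffunP => i; apply/val_inj => /=.
  have := congr1 (fun w : 'cV[int]_d => w i 0) vE.
  rewrite mxE [RHS]mxE [X in _ = X + _]mxE mulD => fE.
  have : ((f i : nat)%:Z %% s`_i)%Z = ((f' i : nat)%:Z %% s`_i)%Z.
    by rewrite fE addrC mulrC modzMDl.
  by rewrite -!(modz_abs _ s`_i) !modz_small ?abszE ?ltz_nat ?ltn_ord//= => -[].
- pose w := invmx L *m k.
  pose u (i : 'I_d) : int := modz (w i 0) s`_i.
  have lt_a i : (absz (u i) < a i)%N.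
    by rewrite -ltz_nat gez0_abs ?modz_ge0// abszE ltz_mod.
  pose f : T := [ffun i => Ordinal (lt_a i)].
  exists f => //; rewrite -[RHS](digit_rep_id detA kP).
  (* L^-1 k equals the residues plus D times the quotients, and L D = A S^-1; hence this witness. *)
  apply/(digit_rep_eqP _ detA); exists (- (invmx S *m \col_i divz (w i 0) s`_i)).
  have -> : v f = w - D *m \col_i divz (w i 0) s`_i.
    apply/colP => i; rewrite mxE ffunE /= gez0_abs ?modz_ge0//.
    rewrite [RHS]mxE [X in _ = _ + X]mxE mulD [X in _ - _ * X]mxE.
    by rewrite /u /modz mulrC.
  by rewrite mulmxBr mulKVmx// AE mulmxN !mulmxA mulmxK.
Qed.

Lemma finite_digits : finite_set (digits R A).
Proof.
have [T [g [gbij _]]] := digits_enumeration.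
by case: gbij => _ _ /sub_finite_set; apply; exact/finite_image/finite_finset.
Qed.

Lemma card_digits (V : pzRingType) :
  \sum_(k \in digits R A) (1 : V) = `|\det A|%:R.
Proof.
have [T [g [gbij <-]]] := digits_enumeration.
rewrite (reindex_fsbig g setT)//.
have -> : [set: T] = [set` enum T] by apply/seteqP; split=> x //= _; exact: mem_enum.
by rewrite -fsbig_seq ?enum_uniq// big_enum/= sumr_const.
Qed.

(** If chi k0 <> 1, translation by k0 permutes the classes and multiplies the sum by chi k0, which
    forces it to vanish. *)
Lemma sum_digits_char (chi : 'cV[int]_d -> R[i]) :
  (forall k l, chi (k + l) = chi k * chi l) -> (forall n, chi (A *m n) = 1) ->
  \sum_(k \in digits R A) chi k =
    if `[< exists k, chi k != 1 >] then 0 else `|\det A|%:R.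
Proof.
move=> chiD chiA.
have chi_rep k : chi (digit_rep R A k) = chi k.
  by rewrite [in RHS](digit_eq R A k) [RHS]chiD chiA mul1r.
case: asboolP => [[k0 k0P]|chi1].
  have : (1 - chi k0) * \sum_(k \in digits R A) chi k = 0.
    rewrite mulrBl mul1r {1}(reindex_fsbig _ _ _ _ (digit_translation_bij R detA k0)).
    rewrite mulr_fsumr; apply/eqP; rewrite subr_eq0; apply/eqP.
    by apply: eq_fsbigr => k _; rewrite chi_rep chiD mulrC.
  by move/eqP; rewrite mulf_eq0 subr_eq0 eq_sym (negPf k0P) => /eqP.
rewrite -card_digits; apply: eq_fsbigr => k _.
by apply/eqP; apply: contra_notT chi1 => ?; exists k.
Qed.

End DigitCount.

(** * Integration on the torus *)

Section CircleTranslation.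
Context {R : realType}.
Local Open Scope ereal_scope.
Local Notation mu := (@lebesgue_measure R).
Local Notation T := (measurableTypeR R).

Lemma measurable_shift (c : R) : measurable_fun setT ((fun x => x + c)%R : T -> T).
Proof. exact: measurable_funD. Qed.

(** The pushforward under the translation agrees with Lebesgue measure on half-open intervals, which
    determine the measure. *)
Lemma lebesgue_measure_shift (c : R) (B : set T) : measurable B ->
  mu ((fun x => x + c)%R @^-1` B) = mu B.
Proof.
pose shift_mixin := isMeasurableFun.Build _ _ _ _ _ (measurable_shift c).
pose shift_pack : {mfun T >-> T} := HB.pack ((fun x => x + c)%R : T -> T) shift_mixin.
move=> mB; have := @lebesgue_measure_unique R (pushforward mu shift_pack).
move=> H; apply/esym/H => // _ [[a b]] _ <-.
rewrite /pushforward /=.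
rewrite [X in _ = mu X](_ : _ = `](a - c)%R, (b - c)%R]%classic); last first.
  by apply/seteqP; split=> x /=; rewrite !in_itv/= ltrBlDr lerBrDr.
by rewrite !lebesgue_measure_itv/= !lte_fin ltrD2r; case: ifP => // _; congr EFin; ring.
Qed.

(** For 0 <= a <= 1 and x in [[0, 1)] this is translation by - a modulo 1: a point leaving on the
    left re-enters on the right. *)
Definition circle_shift (a x : R) : R := (if x < a then x - a + 1 else x - a)%R.

Lemma measurable_circle_shift (a : R) : measurable_fun setT (circle_shift a : T -> T).
Proof.
apply: measurable_fun_ifT.
- exact: measurable_fun_ltr.
- by apply: measurable_funD => //; apply: measurable_funD.
- exact: measurable_funD.
Qed.

(** The interval is cut at a, and the two pieces are exchanged by rigid translations: [[0, a)] goes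
    onto [I2] and [[a, 1)] onto [I1]. *)
Lemma circle_measure_shift (a : R) (B : set T) : (0 <= a <= 1)%R -> measurable B ->
  circle_measure (circle_shift a @^-1` B) = circle_measure B.
Proof.
move=> /andP[a0 a1] mB; rewrite /circle_measure /mrestr.
pose I1 : set T := `[0%R, (1 - a)%R[%classic; pose I2 : set T := `[(1 - a)%R, 1%R[%classic.
have mI1 : measurable (B `&` I1) by apply: measurableI => //; exact: measurable_itv.
have mI2 : measurable (B `&` I2) by apply: measurableI => //; exact: measurable_itv.
have -> : circle_shift a @^-1` B `&` `[0%R, 1%R[%classic =
    (fun x => x + (1 - a))%R @^-1` (B `&` I2) `|` (fun x => x - a)%R @^-1` (B `&` I1).
  apply/seteqP; split => x /=; rewrite /circle_shift !in_itv/=.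
    move=> [Bx /andP[x0 x1]]; case: ltP Bx => xa Bx; [left|right].
    - by split; [rewrite addrA addrAC|rewrite /I2/= in_itv/=; apply/andP; split; lra].
    - by split => //; rewrite /I1/= in_itv/=; apply/andP; split; lra.
  move=> [] []; rewrite /I1 /I2/= in_itv/= => Bx /andP[x0 x1]; split.
  - by move: Bx; case: ltP => xa; [rewrite addrA addrAC|exfalso; lra].
  - by apply/andP; split; lra.
  - by move: Bx; case: ltP => xa; [exfalso; lra|].
  - by apply/andP; split; lra.
have -> : B `&` `[0%R, 1%R[%classic = (B `&` I2) `|` (B `&` I1).
  rewrite -setIUr; congr (_ `&` _); apply/seteqP; split => x; rewrite /I1 /I2/= !in_itv/=.
    by move=> /andP[x0 x1]; case: (ltP x (1 - a)%R) => xa; [right|left]; apply/andP.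
  by case=> /andP[x0 x1]; apply/andP; split; lra.
have mpre c C : measurable C -> measurable ((fun x : T => x + c)%R @^-1` C).
  by move=> mC; rewrite -[X in measurable X]setTI; exact: measurable_shift.
rewrite !measureU//.
- by congr (_ + _); apply: lebesgue_measure_shift.
- by apply/seteqP; split => x //= [[_ +] [_ +]]; rewrite /I1 /I2/= !in_itv/=; lra.
- exact: mpre.
- exact: mpre.
- by apply/seteqP; split => x //= [[_ +] [_ +]]; rewrite /I1 /I2/= !in_itv/=; lra.
Qed.

Lemma ge0_integral_circle_shift (a : R) (f : T -> \bar R) : (0 <= a <= 1)%R ->
  measurable_fun setT f -> (forall x, 0 <= f x) ->
  \int[circle_measure]_x f (circle_shift a x) = \int[circle_measure]_x f x.
Proof.
move=> a01 mf f0.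
have := ge0_integral_pushforward (measurable_circle_shift a)
  (@circle_measure R) measurableT mf (fun y _ => f0 y).
rewrite preimage_setT => /= <-.
apply: eq_measure_integral; first exact: measurable_circle_shift.
by move=> ? A mA _; exact: circle_measure_shift.
Qed.

End CircleTranslation.

Section TorusTranslation.
Context {R : realType}.
Local Open Scope ereal_scope.
Local Notation T := (measurableTypeR R).

Definition torus_shift n (a : 'I_n -> R) (t : n.-tuple T) : n.-tuple T :=
  [tuple circle_shift (a i) (tnth t i) | i < n].

Lemma measurable_torus_shift n (a : 'I_n -> R) :
  measurable_fun setT (torus_shift a).
Proof.
apply/measurable_fun_tnthP => i /=.
rewrite (_ : _ \o _ = circle_shift (a i) \o (fun t : n.-tuple T => tnth t i)).
  apply: measurableT_comp; first exact: measurable_circle_shift.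
  exact: measurable_tnth.
by apply/funext => t /=; rewrite tnth_mktuple.
Qed.

Lemma torus_shift_cons n (a : 'I_n.+1 -> R) (x : T) (t : n.-tuple T) :
  torus_shift a (tcons (x, t)) =
  tcons (circle_shift (a ord0) x, torus_shift (fun i => a (lift ord0 i)) t).
Proof.
apply: eq_from_tnth => i; rewrite tnth_mktuple.
case: (unliftP ord0 i) => [j ->|->]; last by rewrite !tnth0.
by rewrite !tnthS tnth_mktuple.
Qed.

(** The measure is an iterated product, so Tonelli's theorem peels off one coordinate at a time.
    Signed integrands are reached later through their positive and negative parts. *)
Lemma ge0_integral_torus_shift n (a : 'I_n -> R) (f : n.-tuple T -> \bar R) :
  (forall i, 0 <= a i <= 1)%R ->
  measurable_fun setT f -> (forall x, 0 <= f x) ->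
  \int[torus_measure n]_t f (torus_shift a t) = \int[torus_measure n]_t f t.
Proof.
elim: n a f => [|n ih] a f a01 mf f0.
  by apply: eq_integral => t _; congr f; apply: eq_from_tnth => -[].
have mcons : measurable_fun setT (fun z : T * n.-tuple T => f (tcons z)).
  by apply: measurableT_comp => //; exact: measurable_tcons.
have mshift : measurable_fun setT (fun t : n.+1.-tuple T => f (torus_shift a t)).
  by apply: measurableT_comp => //; exact: measurable_torus_shift.
have mshift_cons : measurable_fun setT
    (fun z : T * n.-tuple T => f (torus_shift a (tcons z))).
  by apply: (measurableT_comp mshift); exact: measurable_tcons.
rewrite /= !ge0_integral_distribution//=.
rewrite [LHS]fubini_tonelli1// [RHS]fubini_tonelli1// /fubini_F/=.
pose F x := \int[torus_measure n]_t f (tcons (x, t)).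
transitivity (\int[circle_measure]_x F (circle_shift (a ord0) x)).
  apply: eq_integral => x _; rewrite /F -(ih (fun i => a (lift ord0 i)))//.
    by apply: eq_integral => t _; rewrite torus_shift_cons.
  by apply: (measurableT_comp mcons); exact: measurable_pair1.
apply: ge0_integral_circle_shift => //; last by move=> x; exact: integral_ge0.
exact: (measurable_fun_fubini_tonelli_F (fun z => f (tcons z)) mcons (fun _ => f0 _)).
Qed.

End TorusTranslation.

Lemma normc_ge0 {R : realType} (z : R[i]) : 0 <= normc z.
Proof. by case: z => x y; exact: sqrtr_ge0. Qed.

Lemma normc_ge_ReIm {R : realType} (z : R[i]) :
  `|complex.Re z| <= normc z /\ `|complex.Im z| <= normc z.
Proof.
by case: z => x y /=; rewrite -!sqrtr_sqr !ler_wsqrtr// ?lerDl ?lerDr ?sqr_ge0.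
Qed.

Lemma normc_le_ReIm {R : realType} (z : R[i]) :
  normc z <= `|complex.Re z| + `|complex.Im z|.
Proof.
case: z => x y /=; rewrite -(@ler_pXn2r _ 2)// ?nnegrE ?sqrtr_ge0 ?addr_ge0//.
rewrite sqr_sqrtr ?addr_ge0 ?sqr_ge0// sqrrD !real_normK ?num_real//.
by rewrite addrAC lerDl mulrn_wge0// mulr_ge0.
Qed.

(** * Integrable complex functions on the torus *)

Section TorusIntegrable.
Context {R : realType} {d : nat}.
Implicit Types f g : 'cV[R]_d -> R[i].
Local Notation T := (measurableTypeR R).
Local Notation mu := (@torus_measure R d).

Definition torus_integrable f :=
  mu.-integrable setT (fun t => (complex.Re (f (colt t)))%:E) /\
  mu.-integrable setT (fun t => (complex.Im (f (colt t)))%:E).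

Lemma measurable_normc_colt f :
  measurable_fun setT (fun t => complex.Re (f (colt t))) ->
  measurable_fun setT (fun t => complex.Im (f (colt t))) ->
  measurable_fun setT (fun t : d.-tuple T => normc (f (colt t))).
Proof.
move=> mRe mIm.
rewrite (_ : (fun t => _) = (fun t => Num.sqrt (complex.Re (f (colt t)) ^+ 2 +
    complex.Im (f (colt t)) ^+ 2))); last first.
  by apply/funext => t; case: (f _).
apply: (measurableT_comp (continuous_measurable_fun (@sqrt_continuous R))).
by apply: measurable_funD; exact: measurable_funX.
Qed.

Lemma Lp1P f : Lp 1 f <-> torus_periodic f /\ torus_integrable f.
Proof.
split=> [[pf mRe mIm]|[pf [/integrableP[mRe iRe] /integrableP[mIm iIm]]]].
  rewrite /finite_norm Lnorm1/= => fin; split=> //.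
  have int_norm : mu.-integrable setT (fun t => (normc (f (colt t)))%:E).
    by apply/integrableP; split=> //; apply/measurable_EFinP; exact: measurable_normc_colt.
  split; apply: le_integrable int_norm => //; try exact/measurable_EFinP.
  - move=> t _ /=; rewrite lee_fin [leRHS]ger0_norm ?(normc_ge_ReIm _).1//.
    exact: normc_ge0.
  - move=> t _ /=; rewrite lee_fin [leRHS]ger0_norm ?(normc_ge_ReIm _).2//.
    exact: normc_ge0.
have {}mRe := (measurable_EFinP _ _).1 mRe; have {}mIm := (measurable_EFinP _ _).1 mIm.
split=> //; rewrite /finite_norm Lnorm1/=.
apply: (@le_lt_trans _ _ (\int[mu]_t (`|(complex.Re (f (colt t)))%:E| +
   `|(complex.Im (f (colt t)))%:E|))%E).
  apply: ge0_le_integral => //=.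
  - by apply/measurable_EFinP; apply: measurableT_comp => //; exact: measurable_normc_colt.
  - by apply/measurable_EFinP; apply: measurable_funD; exact: measurableT_comp.
  - move=> t _; rewrite lee_fin ger0_norm ?normc_le_ReIm//.
    exact: normc_ge0.
rewrite ge0_integralD//=; first exact: lte_add_pinfty.
- by apply/measurable_EFinP; exact: measurableT_comp.
- by apply/measurable_EFinP; exact: measurableT_comp.
Qed.

(** The torus has finite measure; hence kernels in L_p are integrable and their Fourier coefficients
    are genuine integrals. *)
Lemma Lp_sub1 p f : (1 <= p)%E -> Lp p f -> Lp 1 f.
Proof.
move=> p1 [pf mRe mIm fin]; split=> //.
have := @Lfun_subset _ _ R mu 1 p (lexx _) p1 (fin_num_measure _ _ measurableT) p1.
move=> /(_ (fun t => normc (f (colt t)))).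
rewrite !inE/= => H; apply/set_mem; apply: (andP (H _)).2.
apply/andP; split; last by rewrite inE.
by rewrite inE; exact: measurable_normc_colt.
Qed.

Lemma torus_integrableD f g : torus_integrable f -> torus_integrable g ->
  torus_integrable (fun x => f x + g x).
Proof.
move=> [f1 f2] [g1 g2]; split.
- apply: eq_integrable (integrableD measurableT f1 g1) => // t _ /=.
  by case: (f _) (g _) => [? ?] [].
- apply: eq_integrable (integrableD measurableT f2 g2) => // t _ /=.
  by case: (f _) (g _) => [? ?] [].
Qed.

Lemma torus_integralD f g : torus_integrable f -> torus_integrable g ->
  torus_integral (fun x => f x + g x) = torus_integral f + torus_integral g.
Proof.
move=> [f1 f2] [g1 g2]; rewrite /torus_integral; apply/eqP; rewrite eq_complex/=.
rewrite -!RintegralD//; apply/andP; split; apply/eqP; apply: eq_Rintegral => t _;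
  by case: (f _) (g _) => [? ?] [].
Qed.

Lemma torus_integrableZ (c : R[i]) f : torus_integrable f ->
  torus_integrable (fun x => c * f x).
Proof.
move=> [f1 f2]; case: c => a b; split.
- apply: eq_integrable (integrableB measurableT (integrableZl measurableT a f1)
     (integrableZl measurableT b f2)) => // t _ /=.
  by case: (f _).
- apply: eq_integrable (integrableD measurableT (integrableZl measurableT a f2)
     (integrableZl measurableT b f1)) => // t _ /=.
  by case: (f _).
Qed.

Lemma torus_integralZ (c : R[i]) f : torus_integrable f ->
  torus_integral (fun x => c * f x) = c * torus_integral f.
Proof.
move=> [f1 f2]; case: c => a b; rewrite /torus_integral; apply/eqP.
rewrite eq_complex/= -!RintegralZl//.
rewrite -RintegralB//; last 2 first.
- by apply: eq_integrable (integrableZl measurableT a f1).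
- by apply: eq_integrable (integrableZl measurableT b f2).
rewrite -RintegralD//; last 2 first.
- by apply: eq_integrable (integrableZl measurableT a f2).
- by apply: eq_integrable (integrableZl measurableT b f1).
by apply/andP; split; apply/eqP; apply: eq_Rintegral => t _; case: (f _).
Qed.

Lemma measurable_colt_coord i : measurable_fun setT (fun t : d.-tuple T => colt t i 0).
Proof.
rewrite (_ : (fun t => _) = (fun t : d.-tuple T => tnth t i)).
  exact: measurable_tnth.
by apply/funext => t; rewrite mxE.
Qed.

Lemma torus_integrable_char (k : 'cV[int]_d) f : torus_integrable f ->
  torus_integrable (fun x => f x * torus_char k x).
Proof.
move=> [f1 f2].
have mdot : measurable_fun setT (fun t : d.-tuple T => 2 * pi * dotp (zvec k) (colt t)).
  apply: measurable_funM => //; rewrite /dotp.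
  apply: measurable_sum => i; apply: measurable_funM => //.
  exact: measurable_colt_coord.
have mcos : measurable_fun setT (fun t : d.-tuple T => cos (2 * pi * dotp (zvec k) (colt t))).
  by apply: measurableT_comp mdot; apply: continuous_measurable_fun; exact: continuous_cos.
have msin : measurable_fun setT (fun t : d.-tuple T => sin (2 * pi * dotp (zvec k) (colt t))).
  by apply: measurableT_comp mdot; apply: continuous_measurable_fun; exact: continuous_sin.
have bcos : [bounded cos (2 * pi * dotp (zvec k) (colt t)) : R^o | t in [set: d.-tuple T]].
  exists 1; split; first exact: num_real.
  by move=> y y1 t _ /=; rewrite (le_trans _ (ltW y1))// ler_norml cos_geN1 cos_le1.
have bsin : [bounded sin (2 * pi * dotp (zvec k) (colt t)) : R^o | t in [set: d.-tuple T]].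
  exists 1; split; first exact: num_real.
  by move=> y y1 t _ /=; rewrite (le_trans _ (ltW y1))// ler_norml sin_geN1 sin_le1.
split.
- apply: eq_integrable (integrableB measurableT (integrableMl measurableT f1 mcos bcos)
     (integrableMl measurableT f2 msin bsin)) => // t _ /=.
  by rewrite /torus_char /expi; case: (f _).
- apply: eq_integrable (integrableD measurableT (integrableMl measurableT f1 msin bsin)
     (integrableMl measurableT f2 mcos bcos)) => // t _ /=.
  by rewrite /torus_char /expi; case: (f _).
Qed.

(** The shift uses the fractional parts of a. The integer parts and the wrap-around corrections form
    k, which varies with t but is invisible to a periodic function. *)
Lemma torus_shiftE (a : 'cV[R]_d) : exists2 a' : 'I_d -> R, (forall i, 0 <= a' i <= 1) &
  forall t, exists k, colt (torus_shift a' t) = colt t - a + zvec k.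
Proof.
exists (fun i => a i 0 - (Num.floor (a i 0))%:~R) => [i|t].
  have := floor_eq (a i 0) (Num.floor (a i 0)); rewrite eqxx intrD => /esym; lra.
pose b i := a i 0 - (Num.floor (a i 0))%:~R.
exists (\col_i (Num.floor (a i 0) + if (tnth t i : R) < b i then 1 else 0)).
apply/colP => i; rewrite !mxE tnth_mktuple /circle_shift intrD /b.
by case: ifP => _ /=; ring.
Qed.

Lemma torus_integrable_translate f (a : 'cV[R]_d) : torus_periodic f ->
  torus_integrable f ->
  torus_integrable (fun x => f (x - a)) /\
  torus_integral (fun x => f (x - a)) = torus_integral f.
Proof.
move=> pf [f1 f2].
have [a' a'01 a'E] := torus_shiftE a.
have fE t : f (colt t - a) = f (colt (torus_shift a' t)).
  by have [k ->] := a'E t; rewrite pf.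
have key (h : d.-tuple T -> R) : mu.-integrable setT (EFin \o h) ->
    mu.-integrable setT (fun t => (h (torus_shift a' t))%:E) /\
    \int[mu]_t h (torus_shift a' t) = \int[mu]_t h t.
  move=> /integrableP[mh ih]; split.
    apply/integrableP; split.
      by apply: (measurableT_comp mh); exact: measurable_torus_shift.
    have := @ge0_integral_torus_shift _ _ a' (fun t => `|(h t)%:E|%E).
    by move=> ->//; exact: measurableT_comp.
  rewrite /Rintegral !(integralE _ _ (fun t => _%:E)); congr fine; congr (_ - _)%E.
    have := @ge0_integral_torus_shift _ _ a' ((EFin \o h)^\+)%E.
    by move=> <-//; [by apply: eq_integral => t _; rewrite !funeposE|exact: measurable_funepos].
  have := @ge0_integral_torus_shift _ _ a' ((EFin \o h)^\-)%E.
  by move=> <-//; [by apply: eq_integral => t _; rewrite !funenegE|exact: measurable_funeneg].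
have [iRe ERe] := key _ f1; have [iIm EIm] := key _ f2.
split.
  split.
  - by apply: eq_integrable iRe => // t _ /=; rewrite fE.
  - by apply: eq_integrable iIm => // t _ /=; rewrite fE.
rewrite /torus_integral -ERe -EIm; congr Complex;
  by apply: eq_Rintegral => t _; rewrite fE.
Qed.

End TorusIntegrable.

(** * Unordered sums *)

Section EsumExtra.
Context {R : realType} {T : choiceType}.
Implicit Types (D : set T) (f g : T -> \bar R).
Local Open Scope ereal_scope.

Lemma esumZ D (c : R) f : (0 <= c)%R -> (forall i, 0 <= f i) ->
  \esum_(i in D) (c%:E * f i) = c%:E * \esum_(i in D) f i.
Proof.
move=> c0 f0; rewrite /esum -ereal_supZl//; last first.
  by apply/set0P; exists (\sum_(x \in set0) f x)%E, set0 => //; exact: fsets_set0.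
congr ereal_sup; apply/seteqP; split=> [_ [X XD <-]|_ [_ [X XD <-] <-]].
  by exists (\sum_(i \in X) f i)%E; [exists X|rewrite ge0_mule_fsumr].
by exists X => //; rewrite ge0_mule_fsumr.
Qed.

Lemma esum_single (r : T) f : 0 <= f r -> (forall i, i != r -> f i = 0) ->
  \esum_(i in setT) f i = f r.
Proof.
move=> f0 fr; rewrite -(esum_set1 f0) [RHS]esum_mkcond; apply: eq_esum => i _.
by case: ifPn => //; rewrite notin_setE/= => /eqP /fr.
Qed.

Lemma esum_ge_term D (r : T) f : D r -> (forall i, 0 <= f i) ->
  f r <= \esum_(i in D) f i.
Proof.
move=> Dr f0; apply: esum_ge; exists [set r]; last by rewrite fsbig_set1.
by split=> // _ ->.
Qed.

End EsumExtra.

(** * Absolutely convergent real and complex families *)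

Section AbsolutelyConvergent.
Context {R : realType} {T : choiceType}.
Implicit Types (u v : T -> R) (x y : T -> R[i]).

Definition rsummable u := summable [set: T] (EFin \o u).

Lemma rsummable_lty u : rsummable u -> (\esum_(i in [set: T]) (u i)%:E < +oo)%E.
Proof. by apply: le_lt_trans; apply: le_esum => i _ /=; rewrite lee_fin ler_norm. Qed.

Lemma rsummable_fin_num u : (forall i, 0 <= u i) -> rsummable u ->
  (\esum_(i in [set: T]) (u i)%:E)%E \is a fin_num.
Proof.
move=> u0 su; rewrite ge0_fin_numE; first exact: rsummable_lty.
by apply: esum_ge0 => i _; rewrite lee_fin.
Qed.

Lemma rsummable_le u v : (forall i, `|u i| <= v i) -> rsummable v -> rsummable u.
Proof.
move=> uv; apply: le_lt_trans; apply: le_esum => i _ /=.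
by rewrite lee_fin (le_trans (uv i))// ler_norm.
Qed.

Lemma rsummableD u v : rsummable u -> rsummable v -> rsummable (fun i => u i + v i).
Proof. by move=> su sv; have := summableD su sv. Qed.

Lemma rsummableN u : rsummable u -> rsummable (fun i => - u i).
Proof. by rewrite /rsummable summableN. Qed.

Lemma rsummableZ c u : rsummable u -> rsummable (fun i => c * u i).
Proof.
move=> su; rewrite /rsummable /summable/=.
rewrite (@eq_esum _ _ _ _ (fun i => `|c|%:E * `|(u i)%:E|)%E); last first.
  by move=> i _; rewrite /= normrM.
by rewrite esumZ// lte_mul_pinfty// ge0_fin_numE//; exact: esum_ge0.
Qed.

(** Any splitting into nonnegative summable families computes the sum, not just the one into
    positive and negative parts; additivity and homogeneity of [rsum] rest on this freedom. *)
Lemma rsumB u v : (forall i, 0 <= u i) -> (forall i, 0 <= v i) ->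
  rsummable u -> rsummable v ->
  rsum (fun i => u i - v i) =
    fine (\esum_(i in [set: T]) (u i)%:E) - fine (\esum_(i in [set: T]) (v i)%:E).
Proof.
move=> u0 v0 su sv; rewrite /rsum.
have := @esumB R T setT (EFin \o u) (EFin \o v) su sv (fun i _ => u0 i) (fun i _ => v0 i).
move=> /(congr1 fine) E; apply: (eq_trans _ (eq_trans E _)) => //=.
by rewrite fineB// rsummable_fin_num.
Qed.

Let pos u i : R := Num.max (u i) 0.
Let neg u i : R := Num.max (- u i) 0.

Let posneg u i : u i = pos u i - neg u i.
Proof.
rewrite /pos /neg; have [u0|/ltW u0] := lerP 0 (u i).
  by rewrite max_r ?subr0// oppr_le0.
by rewrite max_l ?oppr_ge0// sub0r opprK.
Qed.

Let pos_ge0 u i : 0 <= pos u i. Proof. by rewrite le_max lexx orbT. Qed.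
Let neg_ge0 u i : 0 <= neg u i. Proof. by rewrite le_max lexx orbT. Qed.

Let summable_pos u : rsummable u -> rsummable (pos u).
Proof.
move=> su; apply: (@rsummable_le _ (fun i => `|u i|)).
  by move=> i; rewrite ger0_norm// ge_max ler_norm/=.
by apply: le_lt_trans su; apply: le_esum => i _ /=; rewrite normr_id.
Qed.

Let summable_neg u : rsummable u -> rsummable (neg u).
Proof.
move=> su; apply: (@rsummable_le _ (fun i => `|u i|)).
  by move=> i; rewrite ger0_norm// ge_max -normrN ler_norm/=.
by apply: le_lt_trans su; apply: le_esum => i _ /=; rewrite normr_id.
Qed.

Let fine_esumD u v : (forall i, 0 <= u i) -> (forall i, 0 <= v i) ->
  rsummable u -> rsummable v ->
  fine (\esum_(i in [set: T]) (u i + v i)%:E) =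
  fine (\esum_(i in [set: T]) (u i)%:E) + fine (\esum_(i in [set: T]) (v i)%:E).
Proof.
move=> u0 v0 su sv; rewrite -fineD ?rsummable_fin_num//.
by rewrite -esumD// => i _; rewrite lee_fin.
Qed.

Let rsum_posneg u : rsummable u -> rsum u =
  fine (\esum_(i in [set: T]) (pos u i)%:E) - fine (\esum_(i in [set: T]) (neg u i)%:E).
Proof.
move=> su; rewrite -rsumB//; [|exact: summable_pos|exact: summable_neg].
by congr rsum; apply/funext => i; exact: posneg.
Qed.

Lemma rsumD u v : rsummable u -> rsummable v ->
  rsum (fun i => u i + v i) = rsum u + rsum v.
Proof.
move=> su sv; rewrite (rsum_posneg su) (rsum_posneg sv).
have -> : (fun i => u i + v i) = (fun i => (pos u i + pos v i) - (neg u i + neg v i)).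
  by apply/funext => i; rewrite (posneg u) (posneg v); ring.
have pu := summable_pos su; have pv := summable_pos sv.
have nu := summable_neg su; have nv := summable_neg sv.
have p0 i : 0 <= pos u i + pos v i by exact: addr_ge0.
have n0 i : 0 <= neg u i + neg v i by exact: addr_ge0.
rewrite (rsumB p0 n0 (rsummableD pu pv) (rsummableD nu nv)).
rewrite fine_esumD// fine_esumD// opprD.
by rewrite -!addrA; congr (_ + _); rewrite addrCA.
Qed.

Lemma rsumN u : rsummable u -> rsum (fun i => - u i) = - rsum u.
Proof.
move=> su; rewrite (rsum_posneg su) opprB -rsumB//; [|exact: summable_neg|exact: summable_pos].
by congr rsum; apply/funext => i; rewrite (posneg u) opprB.
Qed.

Lemma rsumZ c u : rsummable u -> rsum (fun i => c * u i) = c * rsum u.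
Proof.
wlog c0 : c / 0 <= c => [wl su|su].
  case: (leP 0 c) => [c0|c0]; first exact: wl.
  have := wl (- c); rewrite oppr_ge0 ltW// => /(_ isT su).
  rewrite (_ : (fun i => - c * u i) = (fun i => - (c * u i))); last first.
    by apply/funext => i; rewrite mulNr.
  by rewrite rsumN ?mulNr; [move/oppr_inj|exact: rsummableZ].
rewrite (rsum_posneg su).
have -> : (fun i => c * u i) = (fun i => c * pos u i - c * neg u i).
  by apply/funext => i; rewrite (posneg u) mulrBr.
have p0 i : 0 <= c * pos u i by exact: mulr_ge0.
have n0 i : 0 <= c * neg u i by exact: mulr_ge0.
rewrite (rsumB p0 n0 (rsummableZ c (summable_pos su)) (rsummableZ c (summable_neg su))).
rewrite mulrBr; congr (_ - _).
  under eq_esum do rewrite EFinM.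
  rewrite esumZ ?fineM// => [|i]; last by rewrite lee_fin.
  by apply: rsummable_fin_num => //; exact: summable_pos.
under eq_esum do rewrite EFinM.
rewrite esumZ ?fineM// => [|i]; last by rewrite lee_fin.
by apply: rsummable_fin_num => //; exact: summable_neg.
Qed.

Lemma csummableE x : csummable x = (\esum_(l in [set: T]) (normc (x l))%:E < +oo)%E.
Proof.
by rewrite /csummable /summable; congr (_ < _)%E; apply: eq_esum => l _ /=;
  rewrite ger0_norm// normc_ge0.
Qed.

Lemma csummable_ReIm x : csummable x ->
  rsummable (fun l => complex.Re (x l)) /\ rsummable (fun l => complex.Im (x l)).
Proof.
by move=> sx; split; apply: (rsummable_le _ sx) => l; case: (normc_ge_ReIm (x l)).
Qed.

Lemma csummable_le x (u : T -> R) : (forall l, 0 <= u l) ->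
  (forall l, normc (x l) <= u l) ->
  (\esum_(l in [set: T]) (u l)%:E < +oo)%E -> csummable x.
Proof.
move=> u0 xu su; rewrite csummableE; apply: le_lt_trans su.
by apply: le_esum => l _; rewrite lee_fin.
Qed.

Lemma csummableD x y : csummable x -> csummable y -> csummable (fun l => x l + y l).
Proof.
move=> sx sy; have sxy : rsummable (fun l => normc (x l) + normc (y l)).
  exact: rsummableD.
apply: (@csummable_le _ (fun l => normc (x l) + normc (y l))).
- by move=> l; rewrite addr_ge0 ?normc_ge0.
- by move=> l; exact: le_normcD.
- exact: rsummable_lty.
Qed.

Lemma csummableZ (c : R[i]) x : csummable x -> csummable (fun l => c * x l).
Proof.
move=> sx; apply: (@csummable_le _ (fun l => normc c * normc (x l))).
- by move=> l; rewrite mulr_ge0 ?normc_ge0.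
- by move=> l; rewrite normcM.
- by apply: rsummable_lty; exact: rsummableZ.
Qed.

Lemma csumD x y : csummable x -> csummable y ->
  csum (fun l => x l + y l) = csum x + csum y.
Proof.
move=> /csummable_ReIm[xr xi] /csummable_ReIm[yr yi].
rewrite /csum; apply/eqP; rewrite eq_complex/= -!rsumD//.
by apply/andP; split; apply/eqP; congr rsum; apply/funext => l;
  case: (x l) (y l) => [? ?] [].
Qed.

Lemma csumZ (c : R[i]) x : csummable x -> csum (fun l => c * x l) = c * csum x.
Proof.
move=> /csummable_ReIm[xr xi]; case: c => a b.
have [ar ai br bi] := And4 (rsummableZ a xr) (rsummableZ a xi) (rsummableZ b xr) (rsummableZ b xi).
rewrite /csum; apply/eqP; rewrite eq_complex/= -!rsumZ// -(rsumN bi).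
rewrite -(rsumD ar (rsummableN bi)) -(rsumD ai br).
by apply/andP; split; apply/eqP; congr rsum; apply/funext => l; case: (x l).
Qed.

Lemma csum_single r x : (forall l, l != r -> x l = 0) -> csum x = x r.
Proof.
have rs (u : T -> R) : (forall l, l != r -> u l = 0) -> rsum u = u r.
  move=> ur; rewrite /rsum !(@esum_single _ _ r).
  - by have /(congr1 (fun h => h r))/= <- := funeposneg (EFin \o u).
  - exact: funeneg_ge0.
  - by move=> l lr; rewrite funenegE/= ur// oppr0 maxxx.
  - exact: funepos_ge0.
  - by move=> l lr; rewrite funeposE/= ur// maxxx.
by move=> xr; rewrite /csum !rs; [case: (x r)| |] => // l /xr ->.
Qed.

(** This is what exchanges the finite sum over the digits with the series defining the pairings. *)
Lemma csum_sum (I : Type) (s : seq I) (w : I -> R[i]) (X : I -> T -> R[i]) :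
  (forall k, csummable (X k)) ->
  csummable (fun l => \sum_(k <- s) w k * X k l) /\
  csum (fun l => \sum_(k <- s) w k * X k l) = \sum_(k <- s) w k * csum (X k).
Proof.
move=> sX; elim: s => [|k s [ihs ih]].
  have E : (fun l : T => \sum_(k <- [::]) w k * X k l) = (fun=> 0).
    by apply/funext => l; rewrite big_nil.
  have s0 : csummable (fun _ : T => 0 : R[i]).
    by rewrite csummableE esum1// => l _; rewrite normc0.
  rewrite E big_nil; split=> //; have z := csumZ 0 s0; rewrite [RHS]mul0r in z; rewrite -[RHS]z.
  by congr csum; apply/funext => l; rewrite mul0r.
have E : (fun l => \sum_(k <- k :: s) w k * X k l) =
    (fun l => w k * X k l + \sum_(k <- s) w k * X k l).
  by apply/funext => l; rewrite big_cons.
rewrite E big_cons; split; first exact/csummableD/ihs/csummableZ.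
by rewrite csumD ?ih ?csumZ//; exact: csummableZ.
Qed.

(** The factor 2 arises because the real and imaginary parts are bounded separately. *)
Lemma normc_csum_le x : csummable x ->
  ((normc (csum x))%:E <= 2%:E * \esum_(l in [set: T]) (normc (x l))%:E)%E.
Proof.
move=> sx; have [xr xi] := csummable_ReIm sx.
have fin : (\esum_(l in [set: T]) (normc (x l))%:E \is a fin_num)%E.
  by apply: rsummable_fin_num => // l; exact: normc_ge0.
set S := (\esum_(l in _) _)%E in fin *.
have bound (u : T -> R) : (forall l, `|u l| <= normc (x l)) -> `|rsum u| <= fine S.
  move=> ux; have su : rsummable u := rsummable_le ux sx.
  have posS : fine (\esum_(i in [set: T]) (pos u i)%:E) <= fine S.
    apply: fine_le => //.
      by apply: rsummable_fin_num => //; exact: summable_pos.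
    apply: le_esum => l _; rewrite lee_fin ge_max normc_ge0 andbT.
    exact: le_trans (ler_norm _) (ux l).
  have negS : fine (\esum_(i in [set: T]) (neg u i)%:E) <= fine S.
    apply: fine_le => //.
      by apply: rsummable_fin_num => //; exact: summable_neg.
    apply: le_esum => l _; rewrite lee_fin ge_max normc_ge0 andbT.
    by apply: le_trans (ux l); rewrite -normrN ler_norm.
  have p0 : 0 <= fine (\esum_(i in [set: T]) (pos u i)%:E).
    by apply/fine_ge0/esum_ge0 => l _; rewrite lee_fin.
  have n0 : 0 <= fine (\esum_(i in [set: T]) (neg u i)%:E).
    by apply/fine_ge0/esum_ge0 => l _; rewrite lee_fin.
  by rewrite (rsum_posneg su) ler_norml; apply/andP; split; lra.
rewrite -(fineK fin) -EFinM lee_fin.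
apply: le_trans (normc_le_ReIm _) _ => /=.
rewrite mulr_natl mulr2n lerD// bound// => l; by case: (normc_ge_ReIm (x l)).
Qed.

End AbsolutelyConvergent.

(** * Fourier coefficients of the quasi-projection *)

Section MatrixPowers.
Context {K : comPzRingType} {d : nat}.
Implicit Types (A B : 'M[K]_d) (j : nat).

Lemma det_mxX A j : \det (A ^+ j) = \det A ^+ j.
Proof.
elim: j => [|j ih]; first by rewrite !expr0 det1.
by rewrite !exprS -ih; exact: det_mulmx.
Qed.

Lemma trmx_mxX A j : (A^T ^+ j) = (A ^+ j)^T.
Proof.
elim: j => [|j ih]; first by rewrite !expr0 trmx1.
by rewrite exprS ih exprSr; apply/esym; exact: trmx_mul.
Qed.

End MatrixPowers.

Lemma map_mxX (K L : pzRingType) (h : {rmorphism K -> L}) d (A : 'M[K]_d) j :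
  map_mx h (A ^+ j) = map_mx h A ^+ j.
Proof.
elim: j => [|j ih]; first by rewrite !expr0; exact: map_mx1.
by rewrite !exprS -ih; exact: map_mxM.
Qed.

Section FourierCoefficients.
Context {R : realType} {d : nat}.
Implicit Types (f g : 'cV[R]_d -> R[i]) (x y : 'cV[R]_d) (k l : 'cV[int]_d).

Lemma dotpDl x y z : dotp (x + y) z = dotp x z + dotp y z.
Proof. by rewrite -big_split; apply: eq_bigr => i _; rewrite !mxE mulrDl. Qed.

Lemma dotpC x y : dotp x y = dotp y x.
Proof. by apply: eq_bigr => i _; rewrite mulrC. Qed.

Lemma dotpNl x y : dotp (- x) y = - dotp x y.
Proof. by rewrite -sumrN; apply: eq_bigr => i _; rewrite !mxE mulNr. Qed.

Lemma dotp_mulmxr x y (A : 'M[R]_d) : dotp x (A *m y) = dotp (A^T *m x) y.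
Proof.
rewrite /dotp; under eq_bigr do rewrite mxE mulr_sumr.
rewrite exchange_big/=; apply: eq_bigr => j _; rewrite mxE mulr_suml.
by apply: eq_bigr => i _; rewrite !mxE; ring.
Qed.

Lemma dotp_zvec k l : exists z : int, dotp (zvec k) (zvec l) = z%:~R :> R.
Proof.
exists (\sum_i k i 0 * l i 0); rewrite raddf_sum; apply: eq_bigr => i _.
by rewrite !mxE -intrM.
Qed.

Lemma torus_charD k x y : torus_char k (x + y) = torus_char k x * torus_char k y.
Proof. by rewrite /torus_char dotpC dotpDl expiD !(dotpC _ (zvec k)). Qed.

Lemma periodic_torus_char k : torus_periodic (torus_char k : 'cV[R]_d -> R[i]).
Proof.
move=> x l; rewrite torus_charD {2}/torus_char.
by have [z ->] := dotp_zvec k l; rewrite expi_int mulr1.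
Qed.

Lemma periodicM f g : torus_periodic f -> torus_periodic g ->
  torus_periodic (fun x => f x * g x).
Proof. by move=> pf pg x k; rewrite pf pg. Qed.

Lemma fourierD f g l : torus_integrable f -> torus_integrable g ->
  fourier (fun x => f x + g x) l = fourier f l + fourier g l.
Proof.
move=> intf intg; rewrite /fourier -torus_integralD; [|exact: torus_integrable_char..].
by congr torus_integral; apply/funext => x; rewrite mulrDl.
Qed.

Lemma fourierZ c f l : torus_integrable f ->
  fourier (fun x => c * f x) l = c * fourier f l.
Proof.
move=> intf; rewrite /fourier -torus_integralZ; last exact: torus_integrable_char.
by congr torus_integral; apply/funext => x; rewrite mulrA.
Qed.

Lemma torus_integrable0 : torus_integrable (fun _ : 'cV[R]_d => 0 : R[i]).
Proof. by split; exact: integrable0. Qed.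

Lemma fourier_sum (I : Type) (s : seq I) (c : I -> R[i]) (g : I -> 'cV[R]_d -> R[i]) l :
  (forall i, torus_integrable (g i)) ->
  torus_integrable (fun x => \sum_(i <- s) c i * g i x) /\
  fourier (fun x => \sum_(i <- s) c i * g i x) l = \sum_(i <- s) c i * fourier (g i) l.
Proof.
move=> intg; elim: s => [|i s [ihi ih]].
  rewrite (_ : (fun x => _) = (fun=> 0)); last by apply/funext => x; rewrite big_nil.
  split; first exact: torus_integrable0.
  have z := @fourierZ 0 (fun=> 0) l torus_integrable0; rewrite [RHS]mul0r in z.
  by rewrite big_nil -[RHS]z; congr (fourier _ l); apply/funext => x; rewrite mul0r.
rewrite (_ : (fun x => _) = (fun x => c i * g i x + \sum_(i <- s) c i * g i x)); last first.
  by apply/funext => x; rewrite big_cons.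
have inti := torus_integrableZ (c i) (intg i).
split; first exact: torus_integrableD.
by rewrite fourierD// big_cons ih fourierZ.
Qed.

Lemma fourier_translate f a l : torus_periodic f -> torus_integrable f ->
  fourier (fun x => f (x - a)) l = torus_char (- l) a * fourier f l.
Proof.
move=> pf intf; rewrite /fourier.
have intfc := torus_integrable_char (- l) intf.
have pfc := periodicM pf (periodic_torus_char (- l)).
have [intt <-] := torus_integrable_translate a pfc intfc.
rewrite -torus_integralZ//; congr torus_integral; apply/funext => x.
by rewrite mulrCA -torus_charD (addrC a) subrK.
Qed.

End FourierCoefficients.

Section QuasiProjectionFourier.
Context {R : realType} {d : nat} (M : 'M[int]_d) (j : nat).
Hypothesis detM : \det M != 0.
Variables (f phi : 'cV[R]_d -> R[i]) (tphi : periodic_distribution R d).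
Hypotheses (pphi : torus_periodic phi) (iphi : torus_integrable phi).

Let A := M ^+ j.
Let At := M^T ^+ j.

Lemma detMX : \det (M ^+ j) != 0.
Proof. by rewrite det_mxX expf_neq0. Qed.

Lemma detMTX : \det (M^T ^+ j) != 0.
Proof. by rewrite det_mxX det_tr expf_neq0. Qed.

Definition pairing_coef (l : 'cV[int]_d) := fourier f l * (dfourier tphi l)^*%C.

Hypothesis scoef : csummable pairing_coef.

Lemma csummable_pairing_term k : csummable (pairing_term M j f tphi k).
Proof.
move: scoef; rewrite !csummableE; congr (_ < _)%E; apply: eq_esum => l _.
by congr EFin; rewrite /pairing_term [RHS]normcM normc_expi mulr1.
Qed.

(** The aliased sum over nu, written over all frequencies with the congruence as a condition: this
    is the shape that orthogonality produces. *)
Definition aliased_coef (l : 'cV[int]_d) : R[i] :=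
  csum (fun v => if digit_rep R At v == digit_rep R At l then pairing_coef v else 0).

Lemma torus_char_dilated (l k : 'cV[int]_d) :
  torus_char (- l) (invmx (zmat A) *m zvec k) =
  expi (- dotp (zvec k) (adjpowV R M j *m zvec l)).
Proof.
rewrite /torus_char zvecN dotpNl dotp_mulmxr dotpC.
by rewrite trmx_inv /adjpowV /adjpow trmx_mxX /zmat map_trmx trmxK.
Qed.

(** The exponential is a character in k, trivial on M^j Z^d. It is trivial everywhere exactly when
    the inverse of the adjoint power sends u to an integer vector, that is, when u has digit 0. *)
Lemma sum_digits_expi (u : 'cV[int]_d) :
  \sum_(k \in digits R A) expi (dotp (zvec k) (adjpowV R M j *m zvec u) : R) =
  if digit_rep R At u == 0 then (`|\det M|%N ^ j)%:R else 0.
Proof.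
have uAt : (zmat At : 'M[R]_d) \in unitmx by exact/unitmx_zmat/detMTX.
pose chi (k : 'cV[int]_d) := expi (dotp (zvec k) (adjpowV R M j *m zvec u) : R).
have chiD k l : chi (k + l) = chi k * chi l by rewrite /chi zvecD dotpDl expiD.
have chiA n : chi (A *m n) = 1.
  rewrite /chi zvec_mulmx dotpC dotp_mulmxr.
  rewrite (_ : (zmat A)^T = zmat At); last by rewrite /At trmx_mxX /zmat map_trmx.
  by rewrite mulKVmx//; have [z ->] := @dotp_zvec R _ u n; rewrite expi_int.
have -> : (digit_rep R At u == 0) = ~~ `[< exists k, chi k != 1 >].
  apply/eqP/idP => [u0|/asboolPn chi1].
    apply/asboolPn => -[k]; apply/negP; rewrite negbK; apply/eqP.
    rewrite /chi (digit_eq R At u) u0 addr0 zvec_mulmx mulKmx//.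
    by have [z ->] := @dotp_zvec R _ k (digit_quot R At u); rewrite expi_int.
  (* Evaluating the trivial character at the basis vectors yields integrality of each coordinate. *)
  have intu i : exists z : int, (adjpowV R M j *m zvec u) i 0 = z%:~R :> R.
    apply: expi_eq1; apply: contrapT => ei; apply: chi1.
    exists (delta_mx i 0); apply/eqP; apply: contra_not ei; rewrite /chi.
    rewrite (_ : zvec _ = delta_mx i 0); last exact: map_delta_mx.
    rewrite /dotp (bigD1 i)//= big1 ?addr0 => [|h hi].
      by rewrite mxE !eqxx mul1r.
    by rewrite mxE (negPf hi) mul0r.
  have [z zE] := choice intu.
  have uE : u = At *m (\col_i z i).
    apply: (@zvec_inj R); rewrite zvec_mulmx -[LHS](mulKVmx uAt); congr (_ *m _).
    by apply/colP => i; rewrite [LHS]zE !mxE.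
  have := digit_repD R detMTX 0 (\col_i z i).
  by rewrite add0r -uE (digit_rep_id detMTX (digits0 R detMTX)).
rewrite sum_digits_char//; last exact: detMX.
by case: asboolP => //= _; rewrite det_mxX abszX.
Qed.

(** Translating [phi] by M^-j k produces a phase in l, and the pairing a phase of opposite sign in
    v. Summing over the digits k keeps only the v congruent to l, with a factor that cancels the
    normalisation. *)
Lemma fourier_quasi_projection l :
  [/\ torus_periodic (quasi_projection M j f phi tphi),
      torus_integrable (quasi_projection M j f phi tphi) &
      fourier (quasi_projection M j f phi tphi) l = fourier phi l * aliased_coef l].
Proof.
have finA := finite_digits R detMX.
pose s : seq 'cV[int]_d := finmap.enum_fset (fset_set (digits R A)).
pose w k (x : 'cV[R]_d) := phi (x - invmx (zmat A) *m zvec k).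
have Qx : quasi_projection M j f phi tphi =
    (fun x => (`|\det M|%N ^ j)%:R^-1 * \sum_(k <- s) pairing M j f tphi k * w k x).
  by apply/funext => x; rewrite /quasi_projection fsbig_finite.
have iw k : torus_integrable (w k).
  exact: (torus_integrable_translate _ pphi iphi).1.
have [isum fsum] := fourier_sum s (pairing M j f tphi) l iw.
split; rewrite Qx.
- move=> x k; congr (_ * _); apply: eq_bigr => k' _; congr (_ * _).
  by rewrite /w addrAC pphi.
- exact: torus_integrableZ.
rewrite fourierZ// fsum.
have -> : \sum_(k <- s) pairing M j f tphi k * fourier (w k) l =
    fourier phi l * \sum_(k <- s) expi (- dotp (zvec k) (adjpowV R M j *m zvec l)) *
       pairing M j f tphi k.
  rewrite mulr_sumr; apply: eq_bigr => k _.
  by rewrite fourier_translate// torus_char_dilated; ring.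
rewrite mulrCA; congr (_ * _).
have [_ <-] := csum_sum s (fun k : 'cV[int]_d =>
   expi (- dotp (zvec k) (adjpowV R M j *m zvec l))) csummable_pairing_term.
rewrite -csumZ; last exact: (csum_sum s _ csummable_pairing_term).1.
congr csum; apply/funext => v.
have -> : \sum_(k <- s) expi (- dotp (zvec k) (adjpowV R M j *m zvec l)) *
    pairing_term M j f tphi k v = pairing_coef v *
    \sum_(k \in digits R A) expi (dotp (zvec k) (adjpowV R M j *m zvec (v - l)) : R).
  rewrite fsbig_finite//= mulr_sumr; apply: eq_bigr => k _.
  rewrite /pairing_term -/(pairing_coef v) mulrCA; congr (_ * _).
  by rewrite -expiD zvecD zvecN mulmxDr mulmxN !(dotpC (zvec k)) dotpDl dotpNl addrC.
rewrite sum_digits_expi.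
have -> : (digit_rep R At (v - l) == 0) = (digit_rep R At v == digit_rep R At l).
  rewrite -[X in _ == X](digit_rep_id detMTX (digits0 R detMTX)).
  apply/eqP/eqP => /(digit_rep_eqP R detMTX)[n vE]; apply/(digit_rep_eqP R detMTX); exists n.
    by rewrite -[v](subrK l) vE add0r addrC.
  by rewrite vE addrAC subrr.
case: ifP => _; last by rewrite !mulr0.
by rewrite mulrC mulfK// pnatr_eq0 expn_eq0 absz_eq0 (negPf detM).
Qed.

End QuasiProjectionFourier.

(** * Powers of dilation matrices *)

Lemma normc_real {R : realType} (x : R) : normc x%:C%C = `|x|.
Proof. by rewrite /= expr0n/= addr0 sqrtr_sqr. Qed.

Lemma normcX {R : realType} (z : R[i]) n : normc (z ^+ n) = normc z ^+ n.
Proof. by elim: n => [|n ih]; rewrite ?expr0 ?normc1// !exprS normcM ih. Qed.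

Lemma ler_normc_sum {R : realType} (I : Type) (s : seq I) (P : pred I) (F : I -> R[i]) :
  normc (\sum_(i <- s | P i) F i) <= \sum_(i <- s | P i) normc (F i).
Proof.
elim/big_rec2: _ => [|i x y _ xy]; first by rewrite normc0.
by apply: le_trans (le_normcD _ _) _; rewrite lerD2l.
Qed.

Lemma invmx_uniq (K : comUnitRingType) n (A B : 'M[K]_n) :
  A *m B = 1%:M -> invmx A = B.
Proof.
move=> AB; have [uA _] := mulmx1_unit AB.
by rewrite -[RHS](mulKmx uA) AB mulmx1.
Qed.

(* Multiplying by (A - lam), where 1 < |lam|, cannot turn an unbounded sequence
   A^-j Y into a bounded one, since A^-(j+1) Y = (A^-j Y - A^-(j+1) (A - lam) Y) / lam;
   all the factors of the characteristic polynomial are removed one by one. *)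
Lemma bounded_inverse_powers {R : realType} n (A : 'M[R[i]]_n.+1) (s : seq R[i])
    (W : 'M[R[i]]_n.+1) :
  A \is a GRing.unit -> (forall z, z \in s -> 1 < normc z) ->
  (exists B, forall j i k, normc ((A ^- j * \prod_(z <- s) (A - z%:M) * W) i k) <= B) ->
  exists B, forall j i k, normc ((A ^- j * W) i k) <= B.
Proof.
move=> uA; elim: s => [|z s ih] s1 [B BP].
  by exists B => j i k; have := BP j i k; rewrite big_nil mulr1.
have z1 : 1 < normc z by apply: s1; rewrite inE eqxx.
apply: ih => [z' z's|]; first by apply: s1; rewrite inE z's orbT.
pose Y := \prod_(z <- s) (A - z%:M) * W.
have {}BP j i k : normc ((A ^- j * (A - z%:M) * Y) i k) <= B.
  by have := BP j i k; rewrite big_cons /Y !mulrA.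
have B0 : 0 <= B := le_trans (normc_ge0 _) (BP 0%N 0 0).
pose B' := \sum_(ik : 'I_n.+1 * 'I_n.+1) normc (Y ik.1 ik.2) + B / (normc z - 1).
exists B' => j i k; rewrite -mulrA -/Y.
have B'0 : B <= B' * (normc z - 1).
  rewrite mulrDl divfK ?gt_eqF ?subr_gt0// lerDr mulr_ge0//.
    by apply: sumr_ge0 => *; exact: normc_ge0.
  by rewrite subr_ge0 ltW.
elim: j i k => [|j ihj] i k.
  rewrite expr0 invr1 mul1r /B' (bigD1 (i, k))//= -addrA lerDl addr_ge0//.
    by apply: sumr_ge0 => *; exact: normc_ge0.
  by rewrite divr_ge0// subr_ge0 ltW.
have step : z *: (A ^- j.+1 * Y) = A ^- j * Y - A ^- j.+1 * (A - z%:M) * Y.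
  have VA : A ^- j.+1 * A = A ^- j by rewrite exprS invrM ?unitrX// divrK.
  rewrite mulrBr mulrBl VA opprB addrC subrK.
  by rewrite -[RHS]/(mulmx (mulmx (A ^- j.+1) (z%:M)) Y) mul_mx_scalar -scalemxAl.
have : normc z * normc ((A ^- j.+1 * Y) i k) <= B' + B.
  rewrite -normcM; have := congr1 (fun X : 'M[R[i]]_(n.+1) => X i k) step.
  rewrite mxE => ->; rewrite mxE [X in _ + X]mxE.
  by apply: le_trans (le_normcD _ _) _; rewrite normcN lerD.
move=> zle; rewrite -(ler_pM2l (lt_trans ltr01 z1)); apply: le_trans zle _; lra.
Qed.

Section DilationPowers.
Context {R : realType} {d : nat} (M : 'M[int]_d).

Lemma dilation_det : dilation R M -> \det M != 0.
Proof.
move=> dM; apply/eqP => detM0.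
suff : eigenvalue (cmat R M) 0 by move/dM; rewrite normc0 ltr10.
rewrite eigenvalue_root_char /root horner_coef0 char_poly_det.
by rewrite /cmat det_map_mx detM0 rmorph0 mulr0.
Qed.

Lemma cmat_adjpow j i k :
  (adjpow R M j i k)%:C%C = (cmat R M ^+ j) k i.
Proof.
by rewrite /adjpow trmx_mxX /cmat -map_mxX !mxE -[RHS](rmorph_int (real_complex R)).
Qed.

Lemma cmat_adjpowV j i k : \det M != 0 ->
  (adjpowV R M j i k)%:C%C = (invmx (cmat R M ^+ j)) k i.
Proof.
move=> dM; have uA : (adjpow R M j) \in unitmx by exact/unitmx_zmat/detMTX.
rewrite (@invmx_uniq _ _ _ (map_mx (real_complex R) (adjpowV R M j))^T).
  by rewrite !mxE.
apply: trmx_inj; rewrite trmx_mul trmxK trmx1.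
have -> : (cmat R M ^+ j)^T = map_mx (real_complex R) (adjpow R M j).
  by apply/matrixP => x y; rewrite [RHS]mxE cmat_adjpow mxE.
by rewrite -map_mxM mulVmx// map_mx1.
Qed.

End DilationPowers.

(** By Cayley-Hamilton the product of the factors A - z over all roots z of the characteristic
    polynomial is 0, which gives a trivially bounded sequence to start from;
    [bounded_inverse_powers] then removes the factors. Since the norm of M^-1 may exceed 1, the
    bound cannot be read off the case j = 1. *)
Lemma adjpowV_bounded {R : realType} d (M : 'M[int]_d) : dilation R M ->
  exists2 C, 0 <= C & forall j, opnorm (adjpowV R M j) <= C.
Proof.
(* [bounded_inverse_powers] concerns matrices of positive size; in dimension 0 the norm is 0. *)
case: d M => [|n] M dM.
  exists 0 => // j; apply: le_trans (opnorm_le_entries (lexx 0) _) _; last by rewrite mulr0.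
  by case.
have detM := dilation_det dM.
have uM : cmat R M \is a GRing.unit by rewrite unitmxE det_map_mx unitfE intr_eq0.
have [s sE] := closed_field_poly_normal (char_poly (cmat R M)).
rewrite (monicP (char_poly_monic _)) scale1r in sE.
have [||B BP] := @bounded_inverse_powers R n (cmat R M) s 1 uM _ _.
- move=> z zs; apply: dM; rewrite eigenvalue_root_char sE.
  by rewrite root_prod_XsubC.
- exists 0 => j i k; have := Cayley_Hamilton (cmat R M); rewrite sE rmorph_prod/=.
  under eq_bigr do rewrite rmorphB/= horner_mx_X horner_mx_C.
  by move=> ->; rewrite mulr0 mul0r mxE normc0.
pose C := Num.max B 0; exists (C * (n.+1 * n.+1)%:R).
  by rewrite mulr_ge0// le_max lexx orbT.
move=> j; apply: opnorm_le_entries => [|i k]; first by rewrite le_max lexx orbT.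
rewrite -normc_real cmat_adjpowV// le_max; apply/orP; left.
by have := BP j k i; rewrite mulr1.
Qed.

Section Isotropic.
Context {R : realType} {d : nat} (M : 'M[int]_d).

Lemma isotropic_opnorm (lambda : R[i]) : dilation R M -> isotropic R M ->
  eigenvalue (cmat R M) lambda ->
  exists C, [/\ 0 <= C, forall j, opnorm (adjpow R M j) <= C * normc lambda ^+ j &
                forall j, opnorm (adjpowV R M j) <= C * normc lambda ^- j].
Proof.
move=> dM [P [lam [uP ME lamE]]] eig.
(* The row v P is an eigenvector of the diagonal matrix; a nonzero coordinate h of it forces lam_h =
   lambda, and all diagonal entries share this modulus. *)
have lam_norm i : normc (lam 0 i) = normc lambda.
  have /eigenvalueP[v vE v0] := eig.
  have vP : v *m P *m diag_mx lam = lambda *: (v *m P).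
    rewrite scalemxAl -vE ME -!mulmxA; congr (_ *m _).
    by rewrite mulVmx// mulmx1.
  have [h vh] : exists h, (v *m P) 0 h != 0.
    apply/existsP; apply: contraNT v0 => /existsPn vP0.
    rewrite -[v](mulmxK uP) (_ : v *m P = 0) ?mul0mx//.
    by apply/rowP => h; rewrite [RHS]mxE; have /negbNE/eqP := vP0 h.
  rewrite (lamE i h); congr normc; apply: (mulfI vh).
  have := congr1 (fun w : 'rV[R[i]]_d => w 0 h) vP; rewrite /= mul_mx_diag mxE => ->.
  by rewrite mxE mulrC.
have lam1 : 1 < normc lambda by exact: dM.
have lam_neq0 i : lam 0 i != 0.
  by apply: contraTneq lam1 => li; rewrite -(lam_norm i) li normc0 ltr10.
(* [D f] is f applied to M through its diagonalisation, so powers and inverses reduce to scalar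
   ones. *)
pose D (f : R[i] -> R[i]) : 'M[R[i]]_d := P *m diag_mx (map_mx f lam) *m invmx P.
have DM f g : D f *m D g = D (fun x => f x * g x).
  rewrite /D !mulmxA mulmxKV// -(mulmxA P); congr (_ *m _ *m _).
  apply/matrixP => x y; rewrite mul_diag_mx !mxE.
  by case: eqVneq => [->|_]; rewrite ?mulr1n ?mulr0n ?mulr0.
have Mj j : cmat R M ^+ j = D (fun x => x ^+ j).
  elim: j => [|j ih].
    rewrite expr0 /D (_ : diag_mx _ = 1%:M) ?mulmx1 ?mulmxV//.
    by apply/matrixP => x y; rewrite !mxE expr0.
  rewrite exprS ih -[_ * _]/(_ *m _) ME -{1}[lam](map_mx_id (f := id))// DM.
  by congr D; apply/funext => x; rewrite exprS.
have MVj j : invmx (cmat R M ^+ j) = D (fun x => x ^- j).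
  apply: invmx_uniq; rewrite Mj DM /D (_ : diag_mx _ = 1%:M) ?mulmx1 ?mulmxV//.
  by apply/matrixP => x y; rewrite !mxE divff// expf_neq0.
(* [c] depends only on P, so one constant serves all entries and all j. *)
pose c := \sum_(a : 'I_d) \sum_(b : 'I_d) \sum_(h : 'I_d) normc (P a h) * normc (invmx P h b).
have c_ge0 : 0 <= c.
  by do 3! apply: sumr_ge0 => ? _; rewrite mulr_ge0 ?normc_ge0.
have le_c a b : \sum_h normc (P a h) * normc (invmx P h b) <= c.
  have S0 a' b' : 0 <= \sum_h normc (P a' h) * normc (invmx P h b').
    by apply: sumr_ge0 => h _; rewrite mulr_ge0 ?normc_ge0.
  rewrite /c [leRHS](bigD1 a)//= -[leLHS]addr0 lerD//.
    by rewrite [leRHS](bigD1 b)//= lerDl sumr_ge0.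
  by apply: sumr_ge0 => a' _; apply: sumr_ge0 => b' _; exact: S0.
have Dle f (t : R) a b : (forall h, normc (f (lam 0 h)) = t) -> normc (D f a b) <= c * t.
  move=> ft; rewrite /D mxE; apply: le_trans (ler_normc_sum _ _ _) _.
  have t0 : 0 <= t by rewrite -(ft a) normc_ge0.
  apply: le_trans (ler_wpM2r t0 (le_c a b)).
  rewrite mulr_suml; apply: ler_sum => h _; rewrite mul_mx_diag !mxE !normcM ft.
  by rewrite mulrAC.
exists (c * (d * d)%:R); split; first by rewrite mulr_ge0.
- move=> j; rewrite mulrAC; apply: opnorm_le_entries.
    by rewrite mulr_ge0// exprn_ge0 ?normc_ge0.
  move=> a b; rewrite -normc_real cmat_adjpow Mj; apply: Dle => h.
  by rewrite normcX lam_norm.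
- move=> j; rewrite mulrAC; apply: opnorm_le_entries.
    by rewrite mulr_ge0// invr_ge0 exprn_ge0 ?normc_ge0.
  move=> a b; rewrite -normc_real (cmat_adjpowV _ _ _ (dilation_det dM)) MVj; apply: Dle => h.
  by rewrite normcV normcX lam_norm.
Qed.

End Isotropic.

(** * Sequence norms on the lattice *)

Lemma powR_le {R : realType} (x y r : R) : 0 <= r -> 0 <= x -> x <= y -> x `^ r <= y `^ r.
Proof. by move=> r0 x0 xy; apply: ge0_ler_powR => //; rewrite nnegrE// (le_trans x0). Qed.

Lemma powRN_le {R : realType} (x y r : R) : 0 <= r -> 0 < x -> x <= y ->
  y `^ (- r) <= x `^ (- r).
Proof.
move=> r0 x0 xy; have y0 := lt_le_trans x0 xy.
by rewrite !powRN lef_pV2 ?posrE ?powR_gt0// powR_le// ltW.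
Qed.

Lemma powRNr_gt0_le1 {R : realType} (x r : R) : 0 <= r -> 1 <= x -> x `^ (- r) <= 1.
Proof. by move=> r0 x1; apply: le_trans (powRN_le r0 ltr01 x1) _; rewrite powR1. Qed.

Lemma powR_prod {R : realType} (I : finType) (F : I -> R) (r : R) :
  (forall i, 0 <= F i) -> (\prod_i F i) `^ r = \prod_i F i `^ r.
Proof.
move=> F0; suff [_ ->] : 0 <= \prod_i F i /\ (\prod_i F i) `^ r = \prod_i F i `^ r by [].
elim/big_rec2: _ => [|i y x _ [x0 xy]]; first by rewrite powR1.
by rewrite mulr_ge0//; split => //; rewrite powRM// xy.
Qed.

Section LatticeSums.
Context {R : realType}.

(** Replacing k = 0 by 1 gives every coordinate of a lattice vector, including the zero ones, a
    finite positive factor. *)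
Definition pseries_term (tau : R) (k : nat) : R := (maxn 1 k)%:R `^ (- tau).

(** Cauchy condensation: the block from 2^n to 2^(n+1) has 2^n terms of size at most 2^(- n tau),
    hence a geometric series of ratio 2^(1 - tau) < 1. *)
Lemma pseries_bounded (tau : R) : 1 < tau ->
  exists Z, forall n, \sum_(k < n) pseries_term tau k <= Z.
Proof.
move=> tau1; pose rho : R := 2 `^ (1 - tau).
have rho0 : 0 < rho by exact: powR_gt0.
have rho1 : rho < 1.
  rewrite /rho -[ltRHS](powRr0 (2 : R)) /powR pnatr_eq0/= ltr_expR.
  by rewrite mul0r nmulr_rlt0 ?subr_lt0// ln_gt0// ltr1n.
pose v := pseries_term tau.
have dyadic n : \sum_(0 <= k < 2 ^ n) v k <= 1 + (1 - rho ^+ n) / (1 - rho).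
  elim: n => [|n ih].
    by rewrite expn0 big_nat1 expr0 subrr mul0r addr0 /v /pseries_term maxnE/= powR1.
  rewrite (big_cat_nat (n := (2 ^ n)%N))//=; last by rewrite leq_exp2l.
  have block : \sum_(2 ^ n <= k < 2 ^ n.+1) v k <= rho ^+ n.
    apply: (@le_trans _ _ (\sum_(2 ^ n <= k < 2 ^ n.+1) ((2 ^ n)%:R `^ (- tau)))).
      rewrite !big_nat; apply: ler_sum => k /andP[nk _].
      apply: powRN_le; rewrite ?ler_nat ?ltr0n ?expn_gt0//; first lra.
      by rewrite (leq_trans nk)// leq_maxr.
    rewrite sumr_const_nat expnS mul2n -addnn addnK -[leLHS]mulr_natr.
    rewrite natrX -[(2 ^+ n)%R]powR_mulrn// /rho -[leRHS]powR_mulrn ?powR_ge0//.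
    rewrite -!powRrM -powRD; last by rewrite pnatr_eq0 implybT.
    by rewrite le_eqVlt; apply/orP; left; apply/eqP; congr (_ `^ _); ring.
  apply: le_trans (lerD ih block) _.
  rewrite -addrA lerD2l exprSr; have r1 : 1 - rho != 0 by lra.
  by rewrite le_eqVlt; apply/orP; left; apply/eqP; field.
exists (1 + 1 / (1 - rho)) => n.
apply: (@le_trans _ _ (\sum_(0 <= k < 2 ^ n) v k)).
  rewrite (big_cat_nat (n := n))//=; last exact/ltnW/ltn_expl.
  by rewrite big_mkord lerDl sumr_ge0// => k _; exact: powR_ge0.
apply: le_trans (dyadic n) _; rewrite lerD2l ler_wpM2r ?invr_ge0//; first lra.
by rewrite gerBl exprn_ge0 ?ltW.
Qed.

(** Each factor is at most |n|, the value 1 being covered by |n| >= 1. This separates the variables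
    in the lattice sum. *)
Lemma prod_coord_le_enorm d (n : 'cV[int]_d) : n != 0 ->
  \prod_(i < d) (maxn 1 (absz (n i 0)))%:R <= enorm (zvec n : 'cV[R]_d) ^+ d.
Proof.
move=> n0; rewrite -[X in _ ^+ X]card_ord -prodr_const.
apply: ler_prod => i _; rewrite ler0n/= /maxn; case: ifP => _.
  apply: le_trans (ler_coord_enorm _ i).
  by rewrite mxE -intr_norm natr_absz.
exact: enorm_zvec_ge1.
Qed.

(** Spread evenly over the coordinates, the exponent becomes tau = sigma / d > 1. A finite set of
    vectors embeds in a box, over which the sum of products is a product of one-dimensional sums. *)
Lemma lattice_sum_bounded d (sigma : R) : (0 < d)%N -> d%:R < sigma ->
  (\esum_(n in [set n : 'cV[int]_d | n != 0%R])
     (enorm (zvec n : 'cV[R]_d) `^ (- sigma))%:E < +oo)%E.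
Proof.
move=> d0 dsigma; pose tau := sigma / d%:R.
have dR0 : 0 < d%:R :> R by rewrite ltr0n.
have sigma0 : 0 < sigma by exact: lt_trans dsigma.
have tau1 : 1 < tau by rewrite /tau ltr_pdivlMr// mul1r.
have [Z ZP] := pseries_bounded tau1.
have termle (n : 'cV[int]_d) : n != 0 -> enorm (zvec n : 'cV[R]_d) `^ (- sigma) <=
    \prod_(i < d) pseries_term tau (absz (n i 0)).
  move=> n0.
  rewrite -powR_prod ?ler0n//=.
  have ge1 : 1 <= \prod_(i < d) ((maxn 1 (absz (n i 0)))%:R : R).
    by elim/big_rec: _ => // i x _ x1; rewrite mulr_ege1// ler1n leq_maxl.
  apply: le_trans (powRN_le _ (lt_le_trans ltr01 ge1) (prod_coord_le_enorm n0)); last first.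
    by rewrite ltW// (lt_trans ltr01).
  rewrite -powR_mulrn ?enorm_ge0// -powRrM mulrN /tau.
  by rewrite mulrCA divff ?mulr1// gt_eqF.
(* The factor 2 accounts for the sign of a coordinate; 0 is thereby counted twice, which is harmless
   in an upper bound. *)
apply: (@le_lt_trans _ _ (((2 * Z) ^+ d)%:E)); last exact: ltry.
apply: ge_ereal_sup => _ [X [finX X0] <-].
pose c (n : 'cV[int]_d) i : nat := absz (n i 0).
(* [B] dominates every coordinate of every vector of X, so absolute values fit in ['I_B.+1]. *)
pose B := (\sum_(n <- finmap.enum_fset (fset_set X)) \sum_(i < d) c n i)%N.
have XB n i : X n -> (c n i < B.+1)%N.
  move=> Xn; rewrite ltnS /B (big_rem n)/=; last first.
    by rewrite in_fset_set// inE.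
  by rewrite (bigD1 i)//= -addnA leq_addr.
pose enc (n : 'cV[int]_d) : {ffun 'I_d -> bool * 'I_B.+1} :=
  [ffun i => (n i 0 < 0, inord (c n i))].
pose w (g : {ffun 'I_d -> bool * 'I_B.+1}) := \prod_i pseries_term tau (g i).2.
have enc_inj : set_inj X enc.
  move=> n m /set_mem Xn /set_mem Xm /ffunP e; apply/colP => i.
  have := e i; rewrite !ffunE => -[es /(congr1 val)/=].
  rewrite !inordK ?XB// => ea.
  by rewrite (intEsign (n i 0)) (intEsign (m i 0)) es -/(c n i) -/(c m i) ea.
have termw n : X n -> enorm (zvec n : 'cV[R]_d) `^ (- sigma) <= w (enc n).
  move=> Xn; apply: le_trans (termle n (X0 _ Xn)) _; rewrite le_eqVlt; apply/orP; left.
  by apply/eqP/eq_bigr => i _; rewrite ffunE/= inordK ?XB.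
rewrite -esum_fset//; last by move=> n _; rewrite lee_fin powR_ge0.
apply: (@le_trans _ _ (\esum_(n in X) (w (enc n))%:E)%E).
  by apply: le_esum => n Xn; rewrite lee_fin termw.
rewrite -(@esum_image _ _ _ X enc (fun g => (w g)%:E) enc_inj).
apply: (@le_trans _ _ (\esum_(g in [set: {ffun 'I_d -> bool * 'I_B.+1}]) (w g)%:E)%E).
  rewrite [leLHS]esum_mkcond; apply: le_esum => g _.
  by case: ifP => // _; rewrite lee_fin prodr_ge0// => i _; exact: powR_ge0.
have -> : [set: {ffun 'I_d -> bool * 'I_B.+1}] = [set` enum {ffun 'I_d -> bool * 'I_B.+1}].
  by apply/seteqP; split=> x //= _; exact: mem_enum.
rewrite esum_fset; last 2 first.
- exact: finite_seq.
- by move=> g _; rewrite lee_fin prodr_ge0// => i _; exact: powR_ge0.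
rewrite -fsbig_seq ?enum_uniq// big_enum/= sumEFin lee_fin /w.
rewrite -(bigA_distr_bigA (fun (i : 'I_d) (bk : bool * 'I_B.+1) => pseries_term tau bk.2)).
rewrite prodr_const card_ord ler_pXn2r ?nnegrE//.
- rewrite -(pair_bigA _ (fun (b : bool) (k : 'I_B.+1) => pseries_term tau k))/=.
  by rewrite sumr_const card_bool -[leLHS]mulr_natl; exact: (ler_wpM2l _ (ZP B.+1)).
- by apply: sumr_ge0 => bk _; exact: powR_ge0.
- by rewrite mulr_ge0// (le_trans _ (ZP 0%N))// big_ord0.
Qed.

End LatticeSums.

Lemma powR_add_le {R : realType} (x y r : R) : 0 <= r -> 0 <= x -> 0 <= y ->
  (x + y) `^ r <= 2 `^ r * (x `^ r + y `^ r).
Proof.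
move=> r0 x0 y0.
wlog xy : x y x0 y0 / x <= y => [wl|].
  by have [|/ltW] := leP x y; [exact: wl|rewrite addrC (addrC (x `^ r)); exact: wl].
apply: (@le_trans _ _ ((2 * y) `^ r)).
  by apply: powR_le => //; [rewrite addr_ge0|lra].
by rewrite powRM// ler_wpM2l ?powR_ge0// lerDr powR_ge0.
Qed.

Section SequenceNorm.
Context {R : realType} {T : choiceType}.
Implicit Types (u v : T -> R) (q : \bar R).

(** [wlnorm] with weight and modulus absorbed into the family, so that a coset n -> F (A n + r) is
    treated like the whole lattice. *)
Definition lqnorm q u : \bar R :=
  match q with
  | r%:E => ((\esum_(k in [set: T]) ((u k) `^ r)%:E) `^ r^-1)%E
  | +oo%E => ereal_sup (range (fun k => (u k)%:E))
  | -oo%E => 0%E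
  end.

Lemma esum_powR_fin (r : R) u : 0 < r -> (lqnorm r%:E u < +oo)%E ->
  (\esum_(k in [set: T]) ((u k) `^ r)%:E)%E \is a fin_num.
Proof.
move=> r0 /lty_poweRy h; rewrite ge0_fin_numE ?h// ?invr_eq0 ?gt_eqF//.
by apply: esum_ge0 => k _; rewrite lee_fin powR_ge0.
Qed.

Lemma lqnormE (r : R) u : 0 < r -> (lqnorm r%:E u < +oo)%E ->
  lqnorm r%:E u = ((fine (\esum_(k in [set: T]) ((u k) `^ r)%:E)%E) `^ r^-1)%:E.
Proof. by move=> r0 /(esum_powR_fin r0) fin; rewrite /= -[in LHS](fineK fin) poweR_EFin. Qed.

Lemma fine_esum_powR_ge0 (r : R) u : 0 <= fine (\esum_(k in [set: T]) ((u k) `^ r)%:E)%E.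
Proof. by apply/fine_ge0/esum_ge0 => k _; rewrite lee_fin powR_ge0. Qed.

Lemma lqnorm_powR (r : R) u : 0 < r -> (lqnorm r%:E u < +oo)%E ->
  (fine (lqnorm r%:E u)) `^ r = fine (\esum_(k in [set: T]) ((u k) `^ r)%:E)%E.
Proof.
move=> r0 fin; rewrite lqnormE//= -powRrM mulVf ?gt_eqF// powRr1//.
exact: fine_esum_powR_ge0.
Qed.

Lemma lqnorm_le_esum (r : R) u (c : R) : 0 < r -> 0 <= c ->
  (\esum_(k in [set: T]) ((u k) `^ r)%:E <= c%:E)%E ->
  (lqnorm r%:E u <= (c `^ r^-1)%:E)%E.
Proof.
move=> r0 c0 uc; have e0 : (0 <= \esum_(k in [set: T]) ((u k) `^ r)%:E)%E.
  by apply: esum_ge0 => k _; rewrite lee_fin powR_ge0.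
rewrite /= -poweR_EFin; apply: gt0_ler_poweR => //; first by rewrite invr_ge0 ltW.
- by rewrite in_itv/= e0 leey.
- by rewrite in_itv/= lee_fin c0 leey.
Qed.

Lemma lqnorm_ge_term q u k : (forall k, 0 <= u k) -> (1 <= q)%E ->
  ((u k)%:E <= lqnorm q u)%E.
Proof.
case: q => [r| |]// u0; last by move=> _; apply: ereal_sup_ubound; exists k.
rewrite lee_fin => r1; have r0 : 0 < r := lt_le_trans ltr01 r1.
have [fin|] := ltP (lqnorm r%:E u) +oo%E; last by rewrite leye_eq => /eqP ->; exact: leey.
rewrite lqnormE// lee_fin -[leLHS](powRr1 (u0 k)) -(mulfV (lt0r_neq0 r0)) powRrM.
have rV0 : 0 <= r^-1 by rewrite invr_ge0 ltW.
apply: (powR_le rV0 (powR_ge0 _ _)).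
rewrite -lee_fin fineK ?esum_powR_fin//.
by apply: (@esum_ge_term _ _ setT k (fun k => (u k `^ r)%:E)) => // i; rewrite lee_fin powR_ge0.
Qed.

Lemma lqnorm_ge0 (k0 : T) q u : (forall k, 0 <= u k) -> (1 <= q)%E -> (0 <= lqnorm q u)%E.
Proof. by move=> u0 q1; apply: le_trans (lqnorm_ge_term k0 u0 q1); rewrite lee_fin. Qed.

Lemma lqnormD_fin q u v : (1 <= q)%E -> (forall k, 0 <= u k) -> (forall k, 0 <= v k) ->
  (lqnorm q u < +oo)%E -> (lqnorm q v < +oo)%E -> (lqnorm q (fun k => u k + v k)%R < +oo)%E.
Proof.
case: q => [r| |]// q1 u0 v0 fu fv; last first.
  apply: (@le_lt_trans _ _ (lqnorm +oo%E u + lqnorm +oo%E v)%E); last exact: lte_add_pinfty.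
  by apply: ge_ereal_sup => _ [k _ <-]; rewrite EFinD leeD// lqnorm_ge_term.
have r0 : 0 < r by rewrite (lt_le_trans ltr01)// -lee_fin.
apply: poweR_lty.
apply: (@le_lt_trans _ _ (\esum_(k in [set: T]) ((2 `^ r)%:E * ((u k `^ r)%:E + (v k `^ r)%:E)))%E).
  apply: le_esum => k _; rewrite -EFinD -EFinM lee_fin; apply: powR_add_le => //.
  exact: ltW.
rewrite esumZ ?powR_ge0//; last by move=> k; rewrite adde_ge0// lee_fin powR_ge0.
rewrite esumD; [|by move=> k _; rewrite lee_fin powR_ge0..].
have /fineK <- := esum_powR_fin r0 fu; have /fineK <- := esum_powR_fin r0 fv.
by rewrite -EFinD -EFinM ltry.
Qed.

End SequenceNorm.

(** Applied to n -> A n + r, this makes the norm over each coset finite. *)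
Lemma lqnorm_comp {R : realType} (T T' : choiceType) (e : T -> T') (q : \bar R) (u : T' -> R) :
  injective e -> (forall k, 0 <= u k) -> (1 <= q)%E ->
  (lqnorm q (u \o e) <= lqnorm q u)%E.
Proof.
move=> einj u0; case: q => [r| |]//=; last first.
  by move=> _; apply: ge_ereal_sup => _ [k _ <-]; apply: ereal_sup_ubound; exists (e k).
rewrite lee_fin => r1; have r0 : 0 < r := lt_le_trans ltr01 r1.
have pos (S : set T') : (0 <= \esum_(k in S) ((u k) `^ r)%:E)%E.
  by apply: esum_ge0 => k _; rewrite lee_fin powR_ge0.
rewrite -(@esum_image _ _ _ setT e (fun k => ((u k) `^ r)%:E)); last exact: in2W.
have rV0 : 0 <= r^-1 by rewrite invr_ge0 ltW.
apply: (gt0_ler_poweR rV0); rewrite ?in_itv/= ?pos ?leey//.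
rewrite [leLHS]esum_mkcond; apply: le_esum => k _.
by case: ifP => // _; rewrite lee_fin powR_ge0.
Qed.


(** * From a pointwise bound on cosets to a norm bound *)

Section Assembly.
Context {R : realType} {d : nat}.
Implicit Types (E F B : 'cV[int]_d -> R) (A : 'M[int]_d).

Lemma esum_digits A (g : 'cV[int]_d -> \bar R) : \det A != 0 -> (forall l, (0 <= g l)%E) ->
  (\esum_(l in [set: 'cV[int]_d]) g l =
   \esum_(r in digits R A) \esum_(n in [set: 'cV[int]_d]) g (A *m n + r)%R)%E.
Proof.
move=> dA g0; rewrite esum_esum//.
rewrite (reindex_esum _ _ _ _ (digits_add_bij R dA)).
by congr esum; apply/seteqP; split=> -[r n] [].
Qed.

Definition origin_indicator (n : 'cV[int]_d) : R := (n == 0)%:R.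

Lemma lqnorm_origin_indicator q : (1 <= q)%E -> (lqnorm q origin_indicator < +oo)%E.
Proof.
rewrite /origin_indicator.
case: q => [r| |]// q1; last first.
  apply: (@le_lt_trans _ _ 1%E); last exact: ltry.
  by apply: ge_ereal_sup => _ [k _ <-]; rewrite lee_fin; case: (_ == _).
apply: poweR_lty; have r0 : r != 0 by rewrite gt_eqF// (lt_le_trans ltr01)// -lee_fin.
rewrite (@esum_single _ _ 0) ?lee_fin ?powR_ge0// ?eqxx ?powR1 ?ltry//.
by move=> i /negPf ->; rewrite powR0.
Qed.

(** The constant is chosen before A, E and F, which makes it independent of the level. For finite q
    the q-th powers are summed within a coset, where B and H separate, and then over the digits. *)
Lemma lqnorm_assembly q B : (1 <= q)%E -> (forall n, 0 <= B n) -> (lqnorm q B < +oo)%E ->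
  exists2 c : R, 0 <= c & forall A E F (K : R), \det A != 0 ->
    (forall l, 0 <= E l) -> (forall l, 0 <= F l) -> 0 <= K -> (lqnorm q F < +oo)%E ->
    (forall n r, digits R A r -> E (A *m n + r) <= K * (F (A *m n + r) +
       (B n + origin_indicator n) * fine (lqnorm q (fun n => F (A *m n + r))))) ->
    (lqnorm q E <= (c * K)%:E * lqnorm q F)%E.
Proof.
move=> q1 B0 finB.
pose Bd n := B n + origin_indicator n.
have Bd0 n : 0 <= Bd n by rewrite addr_ge0// /origin_indicator ler0n.
have finBd : (lqnorm q Bd < +oo)%E.
  have o0 n : 0 <= origin_indicator n by exact: ler0n.
  by apply: lqnormD_fin => //; exact: lqnorm_origin_indicator.
case: q q1 B0 finB finBd => [r| |]// q1 B0 finB finBd; last first.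
  have finBd_num : lqnorm +oo%E Bd \is a fin_num.
    by rewrite ge0_fin_numE//; exact: (lqnorm_ge0 0).
  pose beta := fine (lqnorm +oo%E Bd).
  have beta0 : 0 <= beta by exact/fine_ge0/(lqnorm_ge0 0).
  exists (1 + beta); first by rewrite addr_ge0.
  move=> A E F K dA E0 F0 K0 finF EF.
  have finF_num : lqnorm +oo%E F \is a fin_num.
    by rewrite ge0_fin_numE//; exact: (lqnorm_ge0 0).
  apply: ge_ereal_sup => _ [l _ <-].
  rewrite -(fineK finF_num) -EFinM lee_fin (digit_eq R A l).
  apply: le_trans (EF _ _ (digit_rep_digits R dA l)) _.
  set rho := digit_rep R A l; set n := digit_quot R A l.
  have Fle : F (A *m n + rho) <= fine (lqnorm +oo%E F).
    by rewrite -lee_fin fineK//; exact: lqnorm_ge_term.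
  have Ble : Bd n <= beta by rewrite -lee_fin fineK//; exact: lqnorm_ge_term.
  have Hle : fine (lqnorm +oo%E (fun n => F (A *m n + rho))) <= fine (lqnorm +oo%E F).
    have le : (lqnorm +oo%E (fun n => F (A *m n + rho)%R) <= lqnorm +oo%E F)%E.
      by apply: ge_ereal_sup => _ [k _ <-]; exact: lqnorm_ge_term.
    apply: fine_le => //; rewrite ge0_fin_numE ?(le_lt_trans le)//.
    exact: (lqnorm_ge0 0).
  have -> : (1 + beta) * K * fine (lqnorm +oo%E F) =
      K * (fine (lqnorm +oo%E F) + beta * fine (lqnorm +oo%E F)) by ring.
  rewrite ler_wpM2l// lerD//.
  by apply: (ler_pM (Bd0 n) _ Ble Hle); apply: fine_ge0; exact: (lqnorm_ge0 0).
have r0 : 0 < r by rewrite (lt_le_trans ltr01)// -lee_fin.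
have finbeta := esum_powR_fin r0 finBd.
pose beta := fine (\esum_(k in [set: 'cV[int]_d]) ((Bd k) `^ r)%:E)%E.
have beta0 : 0 <= beta by exact: fine_esum_powR_ge0.
exists (2 * (1 + beta) `^ r^-1); first by rewrite mulr_ge0// powR_ge0.
move=> A E F K dA E0 F0 K0 finF EF.
have finS := esum_powR_fin r0 finF.
pose s := fine (\esum_(k in [set: 'cV[int]_d]) ((F k) `^ r)%:E)%E.
have s0 : 0 <= s by exact: fine_esum_powR_ge0.
(* Besides K^r this contains the factor 2^r lost in splitting the r-th power of a sum of two
   terms. *)
pose c0 := (2 * K) `^ r.
have c00 : 0 <= c0 by exact: powR_ge0.
(* [X rho] is the r-th power of the norm of F over the coset of rho. *)
pose X rho : \bar R := (\esum_(n in [set: 'cV[int]_d]) ((F (A *m n + rho)%R) `^ r)%:E)%E.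
have X0 rho : (0 <= X rho)%E by apply: esum_ge0 => k _; rewrite lee_fin powR_ge0.
have SX : (\esum_(rho in digits R A) X rho = s%:E)%E.
  rewrite /s fineK// [RHS](esum_digits dA)// => k; by rewrite lee_fin powR_ge0.
have main : (\esum_(l in [set: 'cV[int]_d]) ((E l) `^ r)%:E <= (c0 * (1 + beta) * s)%:E)%E.
  rewrite (esum_digits dA); last by move=> l; rewrite lee_fin powR_ge0.
  apply: (@le_trans _ _ (\esum_(rho in digits R A) ((c0 * (1 + beta))%:E * X rho))%E).
    apply: le_esum => rho rhoD.
    have Xfin : X rho \is a fin_num.
      rewrite ge0_fin_numE//; apply: (@le_lt_trans _ _ s%:E); last exact: ltry.
      by rewrite -SX; exact: esum_ge_term.
    have Hfin : (lqnorm r%:E (fun n => F (A *m n + rho)%R) < +oo)%E.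
      by apply: poweR_lty; move: Xfin; rewrite ge0_fin_numE.
    apply: (@le_trans _ _ (\esum_(n in [set: 'cV[int]_d]) (c0%:E *
       (((F (A *m n + rho)%R) `^ r)%:E + X rho * ((Bd n) `^ r)%:E)))%E).
      apply: le_esum => n _; rewrite -(fineK Xfin) -EFinM lee_fin.
      apply: le_trans (powR_le (ltW r0) (E0 _) (EF n rho rhoD)) _.
      have H0 : 0 <= fine (lqnorm r%:E (fun n => F (A *m n + rho))).
        by apply: fine_ge0; exact: (lqnorm_ge0 0).
      rewrite -/(Bd n) powRM//; last by rewrite addr_ge0// mulr_ge0.
      have := powR_add_le (ltW r0) (F0 (A *m n + rho)) (mulr_ge0 (Bd0 n) H0).
      rewrite (powRM _ (Bd0 n) H0) lqnorm_powR// -/(X rho) => le2.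
      rewrite /c0 powRM// (mulrC (2 `^ r)) -mulrA ler_wpM2l ?powR_ge0//.
      by rewrite [X in _ <= _ * (_ + X)]mulrC.
    have Bd_pow0 n : (0 <= ((Bd n) `^ r)%:E)%E by rewrite lee_fin powR_ge0.
    have F_pow0 n : (0 <= ((F (A *m n + rho)%R) `^ r)%:E)%E by rewrite lee_fin powR_ge0.
    rewrite esumZ//; last by move=> n; rewrite adde_ge0// mule_ge0.
    rewrite esumD//; last by move=> n _; rewrite mule_ge0.
    rewrite -/(X rho) -(fineK Xfin) esumZ//; last exact: fine_ge0.
    rewrite -(fineK finbeta) -!EFinM lee_fin -/beta le_eqVlt; apply/orP; left.
    by apply/eqP; ring.
  rewrite esumZ//; last by rewrite mulr_ge0// addr_ge0.
  by rewrite SX.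
apply: le_trans (lqnorm_le_esum r0 _ main) _; first by rewrite !mulr_ge0// addr_ge0.
rewrite lqnormE// -EFinM lee_fin -/s /c0.
have b1 : 0 <= 1 + beta by rewrite addr_ge0.
rewrite powRM ?mulr_ge0 ?powR_ge0// powRM ?powR_ge0// -powRrM divff ?lt0r_neq0//.
by rewrite powRr1 ?mulr_ge0//; lra.
Qed.

End Assembly.

(** In the duality estimate the weight is measured by a supremum when q = 1 and by a plain sum when
    q is infinite, so the endpoints are kept apart. *)
Lemma conj_exponent_cases {R : realType} (p q : \bar R) :
  (1 <= q)%E -> (p^-1 + q^-1 = 1)%E ->
  [\/ q = 1%E /\ p = +oo%E,
      exists r : R, [/\ 1 < r, q = r%:E & (p^-1 = (1 - r^-1)%:E)%E]
    | q = +oo%E /\ p = 1%E].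
Proof.
case: q => [r| |]//=; last first.
  move=> _; rewrite invey adde0 => p1; constructor 3; split=> //.
  by rewrite -[p]inveK p1 inve1.
rewrite lee_fin => r1 pq.
have r0 : 0 < r := lt_le_trans ltr01 r1.
have rV : (r%:E^-1 = (r^-1)%:E)%E by rewrite inver gt_eqF.
have pV : (p^-1 = (1 - r^-1)%:E)%E.
  move: pq; rewrite rV; case: (p^-1)%E => [x| |]//= [<-].
  by rewrite addrK.
move: r1; rewrite le_eqVlt => /predU1P[r1|r1].
  constructor 1; split; first by rewrite -r1.
  by rewrite -[p]inveK pV -r1 invr1 subrr inve0.
by constructor 2; exists r.
Qed.

Section Duality.
Context {R : realType} {d : nat}.
Local Notation nrm n := (enorm (zvec n : 'cV[R]_d)).

(* Hoelder's inequality up to a constant: after normalising u, the bound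
   x y <= x^r + y^p' on each term is enough. *)
Lemma lattice_duality (p q : \bar R) (delta : R) : (0 < d)%N ->
  (1 <= q)%E -> (p^-1 + q^-1 = 1)%E ->
  (q != 1%E -> (d%:R%:E * p^-1 < delta%:E)%E) -> (q = 1%E -> 0 <= delta) ->
  exists2 W : R, 0 <= W & forall u : 'cV[int]_d -> R, (forall n, 0 <= u n) ->
    (lqnorm q u < +oo)%E ->
    (\esum_(n in [set n | n != 0%R]) (u n * nrm n `^ (- delta))%R%:E <=
       W%:E * lqnorm q u)%E.
Proof.
move=> d0 q1 pq dq1 deq1.
have dR0 : 0 < d%:R :> R by rewrite ltr0n.
have sub_esum (f : 'cV[int]_d -> \bar R) : (forall n, (0 <= f n)%E) ->
    (\esum_(n in [set n | n != 0%R]) f n <= \esum_(n in [set: 'cV[int]_d]) f n)%E.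
  by move=> f0; rewrite [leLHS]esum_mkcond; apply: le_esum => n _; case: ifP.
have w0 n : 0 <= nrm n `^ (- delta) by exact: powR_ge0.
have [[qE pE]|[r [r1 qE pE]]|[qE pE]] := conj_exponent_cases q1 pq.
- subst q p; exists 1 => // u u0 fin; rewrite mul1e.
  rewrite /= invr1 poweRe1; last by apply: esum_ge0 => n _; rewrite lee_fin powR_ge0.
  apply: (@le_trans _ _ (\esum_(n in [set n | n != 0%R]) (u n `^ 1)%:E)%E).
    apply: le_esum => n n0; rewrite lee_fin powRr1// ler_piMr//.
    by apply: powRNr_gt0_le1; [exact: deq1|exact: enorm_zvec_ge1].
  by apply: sub_esum => n; rewrite lee_fin powR_ge0.
- have r0 : 0 < r := lt_trans ltr01 r1.
  have rV0 : 0 < 1 - r^-1 by rewrite subr_gt0 invf_lt1.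
  pose p' := (1 - r^-1)^-1.
  have p'0 : 0 < p' by rewrite invr_gt0.
  (* The assumption d / p < delta becomes summability of the p'-th power of the weight, p' being the
     real value of p. *)
  have ddelta : d%:R < delta * p'.
    rewrite ltr_pdivlMr// -lte_fin EFinM -pE; apply: dq1.
    by rewrite qE eqe gt_eqF.
  have fin := lattice_sum_bounded d0 ddelta.
  set Sw := esum _ _ in fin.
  have Sw0 : (0 <= Sw)%E by apply: esum_ge0 => n _; rewrite lee_fin powR_ge0.
  have Swfin : Sw \is a fin_num by rewrite ge0_fin_numE.
  exists (1 + fine Sw); first by rewrite addr_ge0// fine_ge0.
  move=> u u0 finu; subst q.
  have finS := esum_powR_fin r0 finu.
  have pow0 n : (0 <= (u n `^ r)%:E)%E by rewrite lee_fin powR_ge0.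
  have h0 : 0 <= fine (lqnorm r%:E u) by apply: fine_ge0; exact: (lqnorm_ge0 0).
  have hE : lqnorm r%:E u = (fine (lqnorm r%:E u))%:E by rewrite lqnormE.
  set h := fine (lqnorm r%:E u) in h0 hE *.
  have hr := lqnorm_powR r0 finu; rewrite -/h in hr.
  (* A zero norm cannot be normalised, but then every u n is 0. *)
  have [h_eq0|h_neq0] := eqVneq h 0.
    rewrite hE h_eq0 mule0 esum1// => n _.
    have : u n <= 0 by rewrite -lee_fin -h_eq0 -hE; exact: lqnorm_ge_term.
    by move=> un; rewrite (_ : u n = 0) ?mul0r//; apply/eqP; rewrite eq_le un u0.
  have hpos : 0 < h by rewrite lt0r h_neq0.
  have hrpos : 0 < h `^ r by exact: powR_gt0.
  apply: (@le_trans _ _ (\esum_(n in [set n | n != 0%R])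
      (h%:E * ((h `^ r)^-1%:E * (u n `^ r)%:E + (nrm n `^ (- (delta * p')))%:E)))%E).
    apply: le_esum => n _; rewrite -!EFinM lee_fin.
    have -> : u n * nrm n `^ (- delta) = h * ((u n / h) * nrm n `^ (- delta)).
      by rewrite mulrA (mulrC h) divfK.
    rewrite ler_wpM2l//.
    have uh0 : 0 <= u n / h by rewrite divr_ge0.
    have rp' : r^-1 + p'^-1 = 1 by rewrite /p' invrK addrC subrK.
    apply: le_trans (conjugate_powR uh0 (w0 n) r0 p'0 rp') _.
    have -> : (u n / h) `^ r = (h `^ r)^-1 * u n `^ r.
      by rewrite powRM ?invr_ge0// -powR_inv1// -powRrM mulN1r powRN mulrC.
    (* The factors 1 / r and 1 / p' of Young's inequality are at most 1 and are dropped. *)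
    rewrite -powRrM mulNr lerD//.
      rewrite ler_pdivrMr// -[leLHS]mulr1 ler_wpM2l ?(ltW r1)//.
      by rewrite mulr_ge0 ?invr_ge0 ?powR_ge0.
    rewrite ler_pdivrMr// -[leLHS]mulr1 ler_wpM2l ?powR_ge0//.
    by rewrite /p' invf_ge1// gerBl invr_ge0 ltW.
  rewrite esumZ//; last by move=> n; rewrite adde_ge0// ?mule_ge0// lee_fin ?invr_ge0 powR_ge0.
  rewrite esumD; [|by move=> n _; rewrite mule_ge0// lee_fin invr_ge0 powR_ge0
    |by move=> n _; rewrite lee_fin powR_ge0].
  rewrite esumZ ?invr_ge0 ?powR_ge0// -/Sw.
  rewrite hE muleC; apply: lee_wpmul2r; first by rewrite lee_fin.
  rewrite EFinD fineK// leeD2r//.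
  apply: (@le_trans _ _ ((h `^ r)^-1%:E * \esum_(n in [set: 'cV[int]_d]) (u n `^ r)%:E)%E).
    by apply: lee_wpmul2l; [rewrite lee_fin invr_ge0 ltW|exact: sub_esum].
  by rewrite -(fineK finS) -EFinM -hr mulVf ?gt_eqF.
- subst q p.
  have ddelta : d%:R < delta.
    by have := dq1 isT; rewrite inve1 mule1 lte_fin.
  have fin := lattice_sum_bounded d0 ddelta.
  set Sw := esum _ _ in fin.
  have Sw0 : (0 <= Sw)%E by apply: esum_ge0 => n _; rewrite lee_fin powR_ge0.
  have Swfin : Sw \is a fin_num by rewrite ge0_fin_numE.
  exists (fine Sw); first by rewrite fine_ge0.
  move=> u u0 finu.
  have hfin : lqnorm +oo%E u \is a fin_num.
    by rewrite ge0_fin_numE//; exact: (lqnorm_ge0 0).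
  have h0 : 0 <= fine (lqnorm +oo%E u) by apply: fine_ge0; exact: (lqnorm_ge0 0).
  rewrite fineK// muleC -(fineK hfin) -esumZ//.
  apply: le_esum => n _; rewrite -EFinM lee_fin ler_wpM2r// -lee_fin fineK//.
  exact: lqnorm_ge_term.
Qed.

End Duality.

(** * Error estimates *)

Lemma normc_conj {R : realType} (z : R[i]) : normc (z^*)%C = normc z.
Proof. by case: z => x y /=; rewrite sqrrN. Qed.

Section Weights.
Context {R : realType} {d : nat}.
Implicit Types (k : 'cV[int]_d) (alpha : R).
Local Notation nrm k := (enorm (zvec k : 'cV[R]_d)).

Lemma theta_ge0 alpha k : 0 <= theta alpha k.
Proof. exact: powR_ge0. Qed.

Lemma theta0 alpha : theta alpha (0 : 'cV[int]_d) = 1.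
Proof. by rewrite /theta zvec0 enorm0 expr0n/= addr0 powR1. Qed.

Lemma theta_ge_powR alpha k : 0 <= alpha -> nrm k `^ alpha <= theta alpha k.
Proof.
move=> a0; rewrite [in leLHS](_ : alpha = 2%:R * (alpha / 2)); last by field.
rewrite powRrM powR_mulrn ?enorm_ge0//.
by apply: powR_le; [rewrite divr_ge0|exact: sqr_ge0|rewrite lerDr].
Qed.

(** Factor theta_alpha = theta_beta theta_(alpha - beta) and bound the last factor below by a power
    of |k|. *)
Lemma theta_quotient alpha beta k : beta <= alpha -> 0 < nrm k ->
  theta beta k <= theta alpha k * nrm k `^ (- (alpha - beta)).
Proof.
move=> ba k0; rewrite powRN ler_pdivlMr ?powR_gt0//.
have -> : theta alpha k = theta beta k * theta (alpha - beta) k.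
  rewrite /theta -powRD; first by congr (_ `^ _); field.
  by apply/implyP => _; rewrite gt_eqF// ltr_pwDl// sqr_ge0.
by rewrite ler_wpM2l ?theta_ge0// theta_ge_powR// subr_ge0.
Qed.

End Weights.

Section ErrorAlgebra.
Context {R : realType}.

(** Splits the error at a digit into a compatibility part and an aliasing part; p, t and S stand for
    the coefficient of phi_j, the conjugate of that of tphi_j, and the aliased sum. *)
Lemma head_identity (f p t S : R[i]) : f - p * S = f * (1 - p * t) - p * (S - f * t).
Proof. by ring. Qed.

Lemma rate_product (aal v H c r rt : R) : 0 <= c -> 0 <= H -> aal * v <= r * rt ->
  aal * (2 * (c * (v * H))) <= 2 * c * r * (rt * H).
Proof.
move=> c0 H0 avr; rewrite (_ : aal * _ = 2 * c * H * (aal * v)); last by ring.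
rewrite (_ : _ * (rt * H) = 2 * c * H * (r * rt)); last by ring.
by apply: ler_wpM2l avr; rewrite mulr_ge0// mulr_ge0.
Qed.

(** For use at a digit r: w = theta_alpha(r), aal = ||A||^alpha, t = |A^-1 r|^s, D bounds the
    aliasing error and Q = rate H(r). *)
Lemma head_product (w err k aal t f b0 c D x y Q : R) : 0 <= w -> 0 <= err -> 0 <= k ->
  0 <= b0 -> 0 <= c -> w <= k * aal -> err <= f * (b0 * t) + c * D ->
  aal * (t * f) <= x * Q -> aal * D <= y * Q -> w * err <= k * (b0 * x + c * y) * Q.
Proof.
move=> w0 err0 k0 b00 c0 wk errle XP YP.
apply: le_trans (ler_pM w0 err0 wk errle) _.
rewrite (_ : k * aal * _ = k * (b0 * (aal * (t * f)) + c * (aal * D))); last by ring.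
rewrite (_ : _ * Q = k * (b0 * (x * Q) + c * (y * Q))); last by ring.
by apply: ler_wpM2l => //; apply: lerD; apply: ler_wpM2l.
Qed.

(** The Strang-Fix part for n <> 0: u = theta_alpha(n), f c + D bounds the aliased sum, and t'
    bounds t independently of r. *)
Lemma tail_product (w k aal u bn t t' f c D x y Q : R) : 0 <= k -> 0 <= u -> 0 <= bn ->
  0 <= t -> t <= t' -> 0 <= f -> 0 <= c -> 0 <= D -> 0 <= aal -> w <= k * aal * u ->
  aal * (t * f) <= x * Q -> aal * D <= y * Q ->
  w * (bn * t * (f * c + D)) <= k * (c * x + t' * y) * (u * bn * Q).
Proof.
move=> k0 u0 bn0 t0 tt' f0 c0 D0 aal0 wk XP YP.
have Z0 : 0 <= bn * t * (f * c + D) by rewrite !mulr_ge0// addr_ge0// mulr_ge0.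
apply: le_trans (ler_wpM2r Z0 wk) _.
rewrite (_ : k * aal * u * _ = k * (u * bn) * (c * (aal * (t * f)) + t * (aal * D))); last by ring.
rewrite (_ : _ * (u * bn * Q) = k * (u * bn) * (c * (x * Q) + t' * (y * Q))); last by ring.
apply: ler_wpM2l; first by rewrite !mulr_ge0.
by apply: lerD; [exact: ler_wpM2l|apply: ler_pM => //; exact: mulr_ge0].
Qed.

Lemma head_total (c1 c2 c3 rt F B H : R) : 0 <= c1 -> 0 <= c2 -> 0 <= c3 -> 0 <= rt ->
  0 <= F -> 0 <= B -> 0 <= H ->
  c2 * (rt * H) <= (c1 + c2 + c3) * rt * (F + (B + 1) * H).
Proof.
move=> c10 c20 c30 rt0 F0 B0 H0; rewrite -subr_ge0.
rewrite (_ : _ - _ = (c1 + c2 + c3) * (rt * F) + (c1 + c2 + c3) * (B * (rt * H)) +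
   (c1 + c3) * (rt * H)); last by ring.
by rewrite !(addr_ge0, mulr_ge0).
Qed.

Lemma tail_total (c1 c2 c3 rt F B H : R) : 0 <= c1 -> 0 <= c2 -> 0 <= c3 -> 0 <= rt ->
  0 <= F -> 0 <= B -> 0 <= H ->
  c1 * rt * F + c3 * (B * (rt * H)) <= (c1 + c2 + c3) * rt * (F + (B + 0) * H).
Proof.
move=> c10 c20 c30 rt0 F0 B0 H0; rewrite -subr_ge0.
rewrite (_ : _ - _ = (c2 + c3) * (rt * F) + (c1 + c2) * (B * (rt * H))); last by ring.
by rewrite !(addr_ge0, mulr_ge0).
Qed.

End ErrorAlgebra.

(** * Pointwise error bound at one level *)

Section DilatedLattice.
Context {R : realType} {d : nat} (A : 'M[int]_d).
Hypotheses (d_gt0 : (0 < d)%N) (detA : \det A != 0).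
Implicit Types (n r l : 'cV[int]_d).
Local Notation nrm k := (enorm (zvec k : 'cV[R]_d)).
Local Notation a := (opnorm (zmat A : 'M[R]_d)).
Local Notation v := (opnorm (invmx (zmat A : 'M[R]_d))).
Local Notation dil l := (invmx (zmat A) *m zvec l : 'cV[R]_d).

Let uA : (zmat A : 'M[R]_d) \in unitmx := unitmx_zmat detA.

Lemma dilated_shift n r : dil (A *m n + r) = zvec n + dil r.
Proof. by rewrite zvecD zvec_mulmx mulmxDr mulKmx. Qed.

Lemma enorm_dilated_digit r : digits R A r -> enorm (dil r) <= d%:R.
Proof.
move=> /(digitsP _ detA) rP; rewrite -[leRHS]mul1r; apply: enorm_le_coord => // i.
by have := rP i; rewrite ler_norml; set x := _ i 0; move=> /andP[? ?]; apply/andP; split; lra.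
Qed.

(** The coordinates y of the dilated digit satisfy |y| <= 1/2, hence |y| <= |n_i| / 2 if n_i <> 0;
    adding y at most halves a coordinate of n. *)
Lemma enorm_le_dilated n r : digits R A r -> nrm n <= 2 * enorm (dil (A *m n + r)).
Proof.
move=> /(digitsP _ detA) rP; rewrite dilated_shift; apply: enorm_le.
  by rewrite mulr_ge0 ?enorm_ge0.
rewrite exprMn sqr_enorm mulr_sumr; apply: ler_sum => i _.
rewrite [zvec n i 0]mxE [X in _ * X ^+ 2]mxE [zvec n i 0]mxE.
have := rP i; set y := (dil r) i 0 => /andP[y1 y2].
have [->|ni] := eqVneq (n i 0) 0; first by rewrite expr0n/= mulr_ge0 ?sqr_ge0.
have : 1 <= `|(n i 0)%:~R : R| by rewrite norm_intr_ge1 ?intr_int ?intr_eq0.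
set z : R := (n i 0)%:~R; rewrite ler_normr => /orP[]; nra.
Qed.

Hypothesis a_ge1 : 1 <= a.

Let av_ge1 : 1 <= a * v := opnorm_mulV_ge1 d_gt0 uA.

Let v_gt0 : 0 < v.
Proof.
rewrite lt0r opnorm_ge0 andbT; apply: contraTneq av_ge1 => ->.
by rewrite mulr0 ler10.
Qed.

Let a_gt0 : 0 < a := lt_le_trans ltr01 a_ge1.

Lemma enorm_le_opnormV l : enorm (dil l) <= v * nrm l.
Proof. exact: enorm_mulmx. Qed.

(** The alpha-th power of ||A|| ||A^-1|| >= 1 is inserted. *)
Lemma powR_opnormV_le alpha mu : 0 <= alpha ->
  v `^ mu <= a `^ alpha * v `^ (mu + alpha).
Proof.
move=> a0; rewrite powRD; last by rewrite (gt_eqF v_gt0) implybT.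
rewrite mulrCA -[leLHS]mulr1 ler_wpM2l ?powR_ge0// -powRM ?opnorm_ge0//.
by have := powR_le a0 ler01 av_ge1; rewrite powR1.
Qed.

(** From |A n + r| <= 2 ||A|| (|n| + d) and ||A|| >= 1 follows 1 + |A n + r|^2 <= ||A||^2 (1 + 8
    |n|^2 + 8 d^2), and the bracket is at most (9 + 8 d^2) (1 + |n|^2). *)
Lemma theta_dilated alpha n r : 0 <= alpha -> digits R A r ->
  theta alpha (A *m n + r) <=
    (9 + 8 * d%:R ^+ 2) `^ (alpha / 2) * a `^ alpha * theta alpha n.
Proof.
move=> a0 rD; set kappa := 9 + 8 * _ ^+ 2.
have kappa0 : 0 <= kappa by rewrite addr_ge0// mulr_ge0// sqr_ge0.
have -> : a `^ alpha = (a ^+ 2) `^ (alpha / 2).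
  by rewrite -powR_mulrn ?opnorm_ge0// -powRrM; congr (_ `^ _); field.
have n0 : 0 <= 1 + nrm n ^+ 2 by rewrite addr_ge0// sqr_ge0.
have ka0 : 0 <= kappa * a ^+ 2 by rewrite mulr_ge0 ?sqr_ge0.
rewrite /theta -powRM ?sqr_ge0// -powRM//.
apply: powR_le; first by rewrite divr_ge0.
  by rewrite addr_ge0// sqr_ge0.
have le1 : nrm (A *m n + r) <= a * (2 * (nrm n + d%:R)).
  rewrite -[zvec (A *m n + r)](mulKVmx uA).
  apply: le_trans (enorm_mulmx _ _) _; rewrite ler_wpM2l ?opnorm_ge0// dilated_shift.
  apply: le_trans (enormD_le _ _) _; rewrite ler_wpM2l// lerD2l.
  exact: enorm_dilated_digit.
have le2 : nrm (A *m n + r) ^+ 2 <= (a * (2 * (nrm n + d%:R))) ^+ 2.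
  by rewrite ler_pXn2r ?nnegrE ?enorm_ge0// mulr_ge0 ?opnorm_ge0// mulr_ge0// addr_ge0 ?enorm_ge0.
have le3 : 1 <= a ^+ 2 by rewrite expr_ge1 ?opnorm_ge0.
have le4 : (2 * (nrm n + d%:R)) ^+ 2 <= 8 * nrm n ^+ 2 + 8 * d%:R ^+ 2.
  by have := sqr_ge0 (nrm n - d%:R); nra.
rewrite exprMn in le2.
apply: (@le_trans _ _ (a ^+ 2 * (1 + (8 * nrm n ^+ 2 + 8 * d%:R ^+ 2)))).
  rewrite mulrDr mulr1 lerD//; apply: le_trans le2 _.
  by rewrite ler_wpM2l ?sqr_ge0.
have -> : kappa * a ^+ 2 * (1 + nrm n ^+ 2) = a ^+ 2 * (kappa * (1 + nrm n ^+ 2)) by ring.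
rewrite ler_wpM2l ?sqr_ge0// /kappa.
by have := sqr_ge0 (nrm n); have := sqr_ge0 (d%:R : R); nra.
Qed.

Section Rates.
Variables (alpha gamma s C0 : R).
Hypotheses (alpha_ge0 : 0 <= alpha) (s_gt0 : 0 < s) (alpha_gamma : alpha < gamma).
Hypotheses (v_le : v <= C0).

Let mu := Num.min gamma (s + alpha) - alpha.
Definition rate : R := a `^ (2 * alpha) * v `^ Num.min gamma (s + alpha).

Lemma rate_ge0 : 0 <= rate.
Proof. by rewrite mulr_ge0 ?powR_ge0. Qed.

Let mu_bounds : [/\ 0 < mu, mu <= s & mu <= gamma - alpha].
Proof.
have m1 : Num.min gamma (s + alpha) <= gamma by rewrite ge_min lexx.
have m2 : Num.min gamma (s + alpha) <= s + alpha by rewrite ge_min lexx orbT.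
have m3 : alpha < Num.min gamma (s + alpha) by rewrite lt_min alpha_gamma ltrDr.
by rewrite /mu; split; lra.
Qed.

Lemma rate_main : a `^ alpha * v `^ mu <= rate.
Proof.
have -> : rate = a `^ alpha * (a `^ alpha * v `^ (mu + alpha)).
  rewrite /rate /mu subrK mulrA -powRD; last by rewrite (gt_eqF a_gt0) implybT.
  by congr (_ `^ _ * _); ring.
by rewrite ler_wpM2l ?powR_ge0// powR_opnormV_le.
Qed.

(** The surplus of gamma over min(gamma, s + alpha) is a nonnegative power of ||A^-1||, absorbed by
    its bound C0. *)
Definition rate_cst : R := C0 `^ (gamma - (mu + alpha)).

Lemma rate_tail : a `^ alpha * v `^ gamma <= rate_cst * rate.
Proof.
have [mu0 mus mug] := mu_bounds.
have -> : v `^ gamma = v `^ (gamma - (mu + alpha)) * v `^ (mu + alpha).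
  by rewrite -powRD ?subrK// (gt_eqF v_gt0) implybT.
rewrite mulrCA ler_pM ?mulr_ge0 ?powR_ge0//.
  by apply: powR_le; rewrite ?opnorm_ge0//; lra.
(* Since ||A|| >= 1, the exponent alpha may be doubled. *)
by rewrite /rate /mu subrK ler_wpM2r ?powR_ge0// ler_powR// ler_peMl ?ler1n.
Qed.

Variables (N Ct Cp : R) (b : 'cV[int]_d -> R) (fh ph th : 'cV[int]_d -> R[i]).
Hypotheses (N_ge0 : 0 <= N) (N_gamma : N <= gamma).
Hypotheses (b_ge0 : forall n, 0 <= b n).
Hypothesis growth_out : forall k, ~ digits R A k -> normc (th k) <= Ct * enorm (dil k) `^ N.
Hypothesis growth_in : forall k, digits R A k -> normc (th k) <= Ct.
Hypothesis strang : forall n r, n != 0 -> digits R A r ->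
  normc (ph (A *m n + r)) <= b n * enorm (dil r) `^ s.
Hypothesis compat : forall r, digits R A r ->
  normc (1 - ph r * (th r)^*%C) <= b 0 * enorm (dil r) `^ s.
Hypothesis bounded : forall r, digits R A r -> normc (ph r) <= Cp.

Let F l := theta gamma l * normc (fh l).
Let F_ge0 l : 0 <= F l. Proof. by rewrite mulr_ge0 ?theta_ge0 ?normc_ge0. Qed.

Let Ct_ge0 : 0 <= Ct := le_trans (normc_ge0 _) (growth_in (digits0 R detA)).
Let Cp_ge0 : 0 <= Cp := le_trans (normc_ge0 _) (bounded (digits0 R detA)).

(** Of the exponent s, the part s - mu is spent on |A^-1 r| <= d and the part mu on |A^-1 r| <=
    ||A^-1|| |r|; then |r|^mu <= |r|^gamma <= theta_gamma(r). *)
Lemma digit_coef_bound r : digits R A r ->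
  a `^ alpha * (enorm (dil r) `^ s * normc (fh r)) <= d%:R `^ (s - mu) * (rate * F r).
Proof.
move=> rD; have [mu0 mus mug] := mu_bounds.
(* The digit 0 is apart because |r| >= 1 fails there; its left side vanishes since s > 0. *)
have [->|r0] := eqVneq r 0.
  rewrite zvec0 mulmx0 enorm0 powR0 ?gt_eqF// mul0r mulr0.
  by rewrite mulr_ge0 ?powR_ge0// mulr_ge0 ?rate_ge0.
have t0 := enorm_ge0 (dil r); have r1 := enorm_zvec_ge1 (R := R) r0.
have -> : enorm (dil r) `^ s = enorm (dil r) `^ (s - mu) * enorm (dil r) `^ mu.
  by rewrite -powRD ?subrK// gt_eqF.
rewrite (_ : _ * (_ * _ * _) = enorm (dil r) `^ (s - mu) *
  (a `^ alpha * (enorm (dil r) `^ mu * normc (fh r)))); last by ring.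
apply: ler_pM; rewrite ?mulr_ge0 ?powR_ge0 ?normc_ge0//.
  by apply: powR_le; rewrite ?subr_ge0// enorm_dilated_digit.
apply: (@le_trans _ _ (a `^ alpha * (v `^ mu * F r))); last first.
  by rewrite mulrA; apply: (ler_wpM2r (F_ge0 r)); exact: rate_main.
rewrite ler_wpM2l ?powR_ge0//.
apply: (@le_trans _ _ (v `^ mu * nrm r `^ mu * normc (fh r))).
  rewrite ler_wpM2r ?normc_ge0// -powRM ?opnorm_ge0 ?enorm_ge0//.
  exact: powR_le (ltW mu0) (enorm_ge0 _) (enorm_le_opnormV _).
rewrite -mulrA ler_wpM2l ?powR_ge0// ler_wpM2r ?normc_ge0//.
apply: le_trans (theta_ge_powR r (ltW (le_lt_trans alpha_ge0 alpha_gamma))).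
by rewrite ler_powR// (le_trans mug)// gerBl.
Qed.

Lemma out_of_digits n r : n != 0 -> digits R A r -> ~ digits R A (A *m n + r).
Proof.
move=> n0 rD /(digit_quot_id detA); rewrite digit_quotP// => /eqP.
exact/negP.
Qed.

Lemma dilated_ge n r : n != 0 -> digits R A r ->
  [/\ nrm n / 2 <= enorm (dil (A *m n + r)), 0 < enorm (dil (A *m n + r)) &
     0 < nrm (A *m n + r)].
Proof.
move=> n0 rD; have n1 := enorm_zvec_ge1 (R := R) n0.
have := enorm_le_dilated n rD; set x := enorm (dil _) => nx.
have x0 : 0 < x by lra.
split=> //; first lra.
by have := enorm_le_opnormV (A *m n + r); rewrite -/x => /(lt_le_trans x0); rewrite pmulr_rgt0.
Qed.

(** For l = A n + r with n <> 0, 1/2 <= |A^-1 l| <= ||A^-1|| |l|; thus 1 / |l| <= 2 ||A^-1||, and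
    the surplus smoothness gamma - alpha turns into a power of ||A^-1||. *)
Lemma tail_bound n r : n != 0 -> digits R A r ->
  theta alpha (A *m n + r) * normc (fh (A *m n + r)) <=
    2 `^ (gamma - alpha) * rate_cst * rate * F (A *m n + r).
Proof.
move=> n0 rD; have [xn x0 l0] := dilated_ge n0 rD; have n1 := enorm_zvec_ge1 (R := R) n0.
have ga : 0 <= gamma - alpha by rewrite subr_ge0 ltW.
have th_le := theta_quotient (ltW alpha_gamma) l0.
have lx := enorm_le_opnormV (A *m n + r).
have lv : nrm (A *m n + r) `^ (- (gamma - alpha)) <= (2 * v) `^ (gamma - alpha).
  have v2 : 0 < (2 * v)^-1 by rewrite invr_gt0 mulr_gt0.
  have -> : (2 * v) `^ (gamma - alpha) = ((2 * v)^-1) `^ (- (gamma - alpha)).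
    by rewrite -[(2 * v)^-1]powR_inv1 ?mulr_ge0 ?opnorm_ge0// -powRrM mulN1r opprK.
  apply: powRN_le => //; rewrite invfM ler_pdivrMr//.
  by apply: le_trans (_ : _ <= enorm (dil (A *m n + r))) _; [lra|rewrite mulrC].
have v_le_rate : v `^ (gamma - alpha) <= rate_cst * rate.
  by apply: le_trans rate_tail; have := powR_opnormV_le (gamma - alpha) alpha_ge0; rewrite subrK.
rewrite /F; apply: le_trans (ler_wpM2r (normc_ge0 _) th_le) _.
rewrite mulrAC -[leRHS]mulrC ler_wpM2l ?mulr_ge0 ?theta_ge0 ?normc_ge0//.
apply: le_trans lv _; rewrite powRM ?opnorm_ge0// -mulrA.
by rewrite ler_wpM2l ?powR_ge0.
Qed.

Definition lattice_coef l := fh l * (th l)^*%C.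

(** With x = |A^-1 l|, smoothness bounds the coefficient of f by F(l) (||A^-1|| / x)^gamma and
    growth adds x^N; then x >= |n| / 2 produces the weight of [duality]. *)
Lemma lattice_coef_bound n r : n != 0 -> digits R A r ->
  normc (lattice_coef (A *m n + r)) <=
    Ct * 2 `^ (gamma - N) * v `^ gamma * (F (A *m n + r) * nrm n `^ (- (gamma - N))).
Proof.
move=> n0 rD; have [xn x0 l0] := dilated_ge n0 rD; have n1 := enorm_zvec_ge1 (R := R) n0.
have g0 : 0 <= gamma := le_trans N_ge0 N_gamma.
have gN : 0 <= gamma - N by rewrite subr_ge0.
have lx := enorm_le_opnormV (A *m n + r).
set l := A *m n + r in xn x0 l0 lx *; set x := enorm (dil l) in xn x0 lx *.
have fle : normc (fh l) <= F l * (v `^ gamma * x `^ (- gamma)).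
  have -> : v `^ gamma * x `^ (- gamma) = (x / v) `^ (- gamma).
    rewrite powRM ?invr_ge0 ?opnorm_ge0 ?ltW// mulrC; congr (_ * _).
    by rewrite -[v^-1]powR_inv1 ?opnorm_ge0// -powRrM mulN1r opprK.
  have := theta_quotient g0 l0; rewrite subr0 /theta mul0r powRr0 -/(theta gamma l) => one_le.
  apply: (@le_trans _ _ (theta gamma l * nrm l `^ (- gamma) * normc (fh l))).
    by rewrite -[leLHS]mul1r ler_wpM2r ?normc_ge0.
  rewrite /F mulrAC ler_wpM2l ?mulr_ge0 ?theta_ge0 ?normc_ge0//.
  apply: powRN_le => //; first by rewrite divr_gt0.
  by rewrite ler_pdivrMr// mulrC.
rewrite /lattice_coef normcM normc_conj.
apply: le_trans (ler_pM (normc_ge0 _) (normc_ge0 _) fle (growth_out (out_of_digits n0 rD))) _.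
rewrite -/l -/x.
have xx : x `^ (- gamma) * x `^ N = x `^ (- (gamma - N)).
  by rewrite -powRD ?(gt_eqF x0) ?implybT//; congr (_ `^ _); ring.
have -> : F l * (v `^ gamma * x `^ (- gamma)) * (Ct * x `^ N) =
    Ct * v `^ gamma * F l * x `^ (- (gamma - N)) by rewrite -xx; ring.
have -> : Ct * 2 `^ (gamma - N) * v `^ gamma * (F l * nrm n `^ (- (gamma - N))) =
   Ct * v `^ gamma * F l * (2 `^ (gamma - N) * nrm n `^ (- (gamma - N))) by ring.
have c0 : 0 <= Ct * v `^ gamma * F l by rewrite mulr_ge0// mulr_ge0// powR_ge0.
rewrite (ler_wpM2l c0)//.
have -> : 2 `^ (gamma - N) * nrm n `^ (- (gamma - N)) = (nrm n / 2) `^ (- (gamma - N)).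
  rewrite powRM ?invr_ge0 ?enorm_ge0// mulrC; congr (_ * _).
  by rewrite -[2^-1]powR_inv1// -powRrM mulN1r opprK.
by apply: powRN_le => //; rewrite divr_gt0// (lt_le_trans ltr01).
Qed.

Definition lattice_alias l : R[i] :=
  csum (fun w => if digit_rep R A w == digit_rep R A l then lattice_coef w else 0).

Variables (q : \bar R) (W : R).
Hypotheses (q_ge1 : (1 <= q)%E) (W_ge0 : 0 <= W).
Hypothesis duality : forall u : 'cV[int]_d -> R, (forall n, 0 <= u n) ->
  (lqnorm q u < +oo)%E ->
  (\esum_(n in [set n | n != 0%R]) (u n * nrm n `^ (- (gamma - N)))%R%:E <=
     W%:E * lqnorm q u)%E.
Hypothesis finF : (lqnorm q F < +oo)%E.

Let H r := fine (lqnorm q (fun n => F (A *m n + r))).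

Let add_inj r : injective (fun n => A *m n + r).
Proof.
move=> n n' /addIr /(congr1 (@zvec R d)); rewrite !zvec_mulmx.
by move=> /(congr1 (mulmx (invmx (zmat A)))); rewrite !mulKmx// => /zvec_inj.
Qed.

Let finH r : (lqnorm q (fun n => F (A *m n + r)%R) < +oo)%E.
Proof. exact: le_lt_trans (lqnorm_comp (@add_inj r) F_ge0 q_ge1) finF. Qed.

Let HE r : (lqnorm q (fun n => F (A *m n + r)%R) = (H r)%:E)%E.
Proof. by rewrite /H fineK// ge0_fin_numE//; exact: (lqnorm_ge0 0). Qed.

Let H_ge0 r : 0 <= H r.
Proof. by rewrite -lee_fin -HE; exact: (lqnorm_ge0 0). Qed.

Let F_le_H r : F r <= H r.
Proof.
rewrite -lee_fin -HE; have := @lqnorm_ge_term _ _ q (fun n => F (A *m n + r)) 0.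
by rewrite mulmx0 add0r; apply.
Qed.

Definition tail_cst : R := Ct * 2 `^ (gamma - N) * W.

Let tail_cst_ge0 : 0 <= tail_cst.
Proof. by rewrite mulr_ge0// mulr_ge0// powR_ge0. Qed.

Lemma tail_esum r : digits R A r ->
  (\esum_(n in [set n | n != 0%R]) (normc (lattice_coef (A *m n + r)%R))%:E <=
    (tail_cst * (v `^ gamma * H r))%:E)%E.
Proof.
move=> rD; pose c := Ct * 2 `^ (gamma - N) * v `^ gamma.
have c0 : 0 <= c by rewrite mulr_ge0 ?powR_ge0// mulr_ge0 ?powR_ge0.
apply: (@le_trans _ _ (\esum_(n in [set n | n != 0%R])
   (c%:E * (F (A *m n + r) * nrm n `^ (- (gamma - N)))%R%:E))%E).
  by apply: le_esum => n n0; rewrite -EFinM lee_fin; exact: lattice_coef_bound.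
rewrite esumZ//; last by move=> n; rewrite lee_fin mulr_ge0// powR_ge0.
apply: le_trans (lee_wpmul2l _ (duality (fun n => F_ge0 _) (finH r))) _; first by rewrite lee_fin.
by rewrite HE -!EFinM lee_fin le_eqVlt; apply/orP; left; apply/eqP; rewrite /c /tail_cst; ring.
Qed.

(** Each coset is summable by duality and there are finitely many; this is the convergence of the
    pairings. *)
Lemma csummable_lattice_coef : csummable lattice_coef.
Proof.
rewrite csummableE (esum_digits detA); last by move=> l; rewrite lee_fin normc_ge0.
have inner r : digits R A r -> (\esum_(n in [set: 'cV[int]_d])
    (normc (lattice_coef (A *m n + r)%R))%:E < +oo)%E.
  move=> rD; have g0 n : (0 <= (normc (lattice_coef (A *m n + r)%R))%:E)%E.
    by rewrite lee_fin normc_ge0.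
  rewrite (esumID [set 0])//; apply: lte_add_pinfty.
    by rewrite setTI esum_set1// ltry.
  rewrite setTI; have -> : ~` [set 0 : 'cV[int]_d] = [set n | n != 0].
    by apply/seteqP; split=> n /= /eqP.
  exact: le_lt_trans (tail_esum rD) (ltry _).
have finD := finite_digits R detA.
rewrite (_ : digits R A = [set` finmap.enum_fset (fset_set (digits R A))]); last first.
  by apply/seteqP; split=> r /=; rewrite in_fset_set// inE.
rewrite esum_fset; last 2 first.
- exact: finite_seq.
- by move=> r _; apply: esum_ge0 => n _; rewrite lee_fin normc_ge0.
rewrite -fsbig_seq ?finmap.fset_uniq//.
rewrite big_seq; apply: lte_sum_pinfty => r; rewrite in_fset_set// => /set_mem rD.
exact: inner.
Qed.

(** The term at r is set aside, since compatibility compares it with the coefficient of f; the rest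
    of the coset is the tail n <> 0, and the 2 is that of [normc_csum_le]. *)
Lemma lattice_alias_error n r : digits R A r ->
  normc (lattice_alias (A *m n + r) - lattice_coef r) <= 2 * (tail_cst * (v `^ gamma * H r)).
Proof.
move=> rD; pose P w := digit_rep R A w == r.
pose x w := if P w then lattice_coef w else 0.
pose x1 w := if w == r then lattice_coef r else 0.
pose x2 w := if P w && (w != r) then lattice_coef w else 0.
have Pr : P r by rewrite /P digit_rep_id.
have sub (y : 'cV[int]_d -> R[i]) : (forall w, normc (y w) <= normc (lattice_coef w)) ->
    csummable y.
  move=> yle; apply: (csummable_le (fun w => normc_ge0 (lattice_coef w)) yle).
  by rewrite -csummableE; exact: csummable_lattice_coef.
have s1 : csummable x1.
  by apply: sub => w; rewrite /x1; case: eqP => [->//|_]; rewrite normc0 normc_ge0.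
have s2 : csummable x2.
  by apply: sub => w; rewrite /x2; case: ifP => // _; rewrite normc0 normc_ge0.
have -> : lattice_alias (A *m n + r) = lattice_coef r + csum x2.
  have <- : csum x1 = lattice_coef r.
    rewrite (@csum_single _ _ r) /x1 ?eqxx// => w /negPf ->//.
  rewrite /lattice_alias digit_repP// -csumD//; congr csum; apply/funext => w.
  rewrite /x1 /x2 -/(P w); case: (eqVneq w r) => [->|wr]; first by rewrite Pr andbF addr0.
  by rewrite add0r andbT.
rewrite addrC addKr -lee_fin; apply: le_trans (normc_csum_le s2) _.
rewrite [leRHS]EFinM; apply: lee_wpmul2l => //.
apply: le_trans (tail_esum rD).
have -> : (\esum_(w in [set: 'cV[int]_d]) (normc (x2 w))%:E =
    \esum_(w in [set w | P w && (w != r)]) (normc (lattice_coef w))%:E)%E.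
  rewrite [RHS]esum_mkcond; apply: eq_esum => w _; rewrite /x2.
  case: ifPn => h; case: ifPn => //; rewrite ?normc0//.
  - by move=> /negP; rewrite inE.
  - by rewrite inE/= (negPf h).
rewrite -(@esum_image _ _ _ [set n | n != 0%R] (fun n => A *m n + r)
  (fun w => (normc (lattice_coef w))%:E)); last by move=> ? ? _ _; exact: add_inj.
rewrite [leLHS]esum_mkcond [leRHS]esum_mkcond; apply: le_esum => w _.
case: ifPn => [|_]; last by case: ifP => // _; rewrite lee_fin normc_ge0.
rewrite inE/= => /andP[Pw wr]; rewrite ifT// inE/=; exists (digit_quot R A w).
  apply: contraNneq wr => q0; apply/eqP.
  by rewrite (digit_eq R A w) q0 mulmx0 add0r; exact/eqP.
by rewrite /= -(eqP Pw) -digit_eq.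
Qed.

Definition theta_cst : R := (9 + 8 * d%:R ^+ 2) `^ (alpha / 2).

(** The summands belong, in order, to f outside D(A), to the error at the digits, and to the
    Strang-Fix terms outside D(A). *)
Definition error_cst : R :=
  2 `^ (gamma - alpha) * rate_cst +
  theta_cst * (b 0 * d%:R `^ (s - mu) + Cp * (2 * tail_cst * rate_cst)) +
  theta_cst * (Ct * d%:R `^ (s - mu) + d%:R `^ s * (2 * tail_cst * rate_cst)).

Let rate_cst_ge0 : 0 <= rate_cst. Proof. exact: powR_ge0. Qed.
Let theta_cst_ge0 : 0 <= theta_cst. Proof. exact: powR_ge0. Qed.

Lemma lattice_error_bound n r : digits R A r ->
  theta alpha (A *m n + r) *
    normc (fh (A *m n + r) - ph (A *m n + r) * lattice_alias (A *m n + r)) <=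
  error_cst * rate * (F (A *m n + r) +
    (theta alpha n * b n + origin_indicator n) * H r).
Proof.
move=> rD; set S := lattice_alias _.
set D := 2 * (tail_cst * (v `^ gamma * H r)).
have SD : normc (S - lattice_coef r) <= D by exact: lattice_alias_error.
set t := enorm (dil r) `^ s.
have t0 : 0 <= t by exact: powR_ge0.
have td : t <= d%:R `^ s.
  by apply: (powR_le (ltW s_gt0) (enorm_ge0 _)); exact: enorm_dilated_digit.
have XF : a `^ alpha * (t * normc (fh r)) <= d%:R `^ (s - mu) * (rate * H r).
  apply: le_trans (digit_coef_bound rD) _; apply: ler_wpM2l; first exact: powR_ge0.
  by apply: ler_wpM2l (F_le_H r); exact: rate_ge0.
have XD : a `^ alpha * D <= 2 * tail_cst * rate_cst * (rate * H r).
  exact: rate_product tail_cst_ge0 (H_ge0 r) rate_tail.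
have D0 : 0 <= D by apply: le_trans SD; exact: normc_ge0.
have th_le := theta_dilated n alpha_ge0 rD.
have Bn0 : 0 <= theta alpha n * b n by rewrite mulr_ge0 ?theta_ge0.
have aal : 0 <= a `^ alpha by exact: powR_ge0.
have dmu0 : 0 <= d%:R `^ (s - mu) :> R by exact: powR_ge0.
have ds0 : 0 <= d%:R `^ s :> R by exact: powR_ge0.
pose c1 := 2 `^ (gamma - alpha) * rate_cst.
pose c2 := theta_cst * (b 0 * d%:R `^ (s - mu) + Cp * (2 * tail_cst * rate_cst)).
pose c3 := theta_cst * (Ct * d%:R `^ (s - mu) + d%:R `^ s * (2 * tail_cst * rate_cst)).
have c10 : 0 <= c1 by rewrite mulr_ge0 ?powR_ge0.
have tr0 : 0 <= 2 * tail_cst * rate_cst by rewrite mulr_ge0// mulr_ge0.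
have c20 : 0 <= c2 by rewrite mulr_ge0// addr_ge0// mulr_ge0.
have c30 : 0 <= c3 by rewrite mulr_ge0// addr_ge0// mulr_ge0.
rewrite -[error_cst]/(c1 + c2 + c3).
(* At a digit, f and its approximation nearly cancel by compatibility; elsewhere each is small by
   itself and the triangle inequality suffices. *)
have [n0|n0] := eqVneq n 0.
  have -> : origin_indicator n = 1 by rewrite /origin_indicator n0 eqxx.
  apply: (le_trans _ (head_total c10 c20 c30 rate_ge0 (F_ge0 _) Bn0 (H_ge0 r))).
  have th_r : theta alpha (A *m n + r) <= theta_cst * a `^ alpha.
    by apply: le_trans th_le _; rewrite n0 theta0 mulr1.
  have lr : A *m n + r = r by rewrite n0 mulmx0 add0r.
  rewrite lr in th_r *.
  have le1 : normc (fh r - ph r * S) <= normc (fh r) * (b 0 * t) + Cp * D.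
    rewrite (head_identity _ _ (th r)^*%C) -/(lattice_coef r).
    apply: le_trans (le_normcD _ _) _; rewrite normcN !normcM; apply: lerD.
      by apply: ler_wpM2l (compat rD); exact: normc_ge0.
    by apply: ler_pM (bounded rD) SD; exact: normc_ge0.
  exact: head_product (theta_ge0 _ _) (normc_ge0 _) theta_cst_ge0 (b_ge0 0)
    Cp_ge0 th_r le1 XF XD.
have -> : origin_indicator n = 0 by rewrite /origin_indicator (negPf n0).
apply: (le_trans _ (tail_total c10 c20 c30 rate_ge0 (F_ge0 _) Bn0 (H_ge0 r))).
have le1 : normc (fh (A *m n + r) - ph (A *m n + r) * S) <=
    normc (fh (A *m n + r)) + b n * t * (normc (fh r) * Ct + D).
  apply: le_trans (le_normcD _ _) _; rewrite normcN normcM lerD2l.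
  apply: ler_pM (normc_ge0 _) (normc_ge0 _) (strang n0 rD) _.
  rewrite -[S](subrK (lattice_coef r)) addrC; apply: le_trans (le_normcD _ _) _.
  apply: lerD SD; rewrite /lattice_coef normcM normc_conj.
  by apply: ler_wpM2l (growth_in rD); exact: normc_ge0.
apply: le_trans (ler_wpM2l (theta_ge0 _ _) le1) _; rewrite mulrDr; apply: lerD.
  exact: tail_bound.
exact: tail_product theta_cst_ge0 (theta_ge0 _ _) (b_ge0 n) t0 td (normc_ge0 _) Ct_ge0 D0 aal
  th_le XF XD.
Qed.

Lemma error_cst_ge0 : 0 <= error_cst.
Proof.
have tr0 : 0 <= 2 * tail_cst * rate_cst by rewrite mulr_ge0// mulr_ge0.
by rewrite /error_cst !addr_ge0// mulr_ge0 ?powR_ge0// addr_ge0// mulr_ge0 ?powR_ge0.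
Qed.

End Rates.
End DilatedLattice.

Lemma wlnormE {R : realType} d q alpha (x : 'cV[int]_d -> R[i]) :
  wlnorm q alpha x = lqnorm q (fun k => theta alpha k * normc (x k)).
Proof. by case: q. Qed.

Lemma conj_exponent_ge1 {R : realType} (p q : \bar R) :
  (1 <= q)%E -> (p^-1 + q^-1 = 1)%E -> (1 <= p)%E.
Proof.
move=> q1 pq; have [[_ ->]|[r [r1 _ pE]]|[_ ->]] := conj_exponent_cases q1 pq => //.
  exact: leey.
have rV : 0 < 1 - r^-1 by rewrite subr_gt0 invf_lt1// (lt_trans ltr01).
have -> : p = ((1 - r^-1)^-1)%:E by rewrite -[p]inveK pE inver gt_eqF.
by rewrite lee_fin invf_ge1// gerBl invr_ge0 (le_trans ler01)// ltW.
Qed.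

Lemma conj_exponent_inv_ge0 {R : realType} (p q : \bar R) :
  (1 <= q)%E -> (p^-1 + q^-1 = 1)%E -> exists2 x : R, 0 <= x & (p^-1 = x%:E)%E.
Proof.
move=> q1 pq; have [[_ ->]|[r [r1 _ ->]]|[_ ->]] := conj_exponent_cases q1 pq.
- by exists 0 => //; rewrite invey.
- by exists (1 - r^-1) => //; rewrite subr_ge0 invf_le1 ?ltW// (lt_trans ltr01).
- by exists 1 => //; rewrite inve1.
Qed.

(** * Uniformity in the level *)

Section QuasiError.
Context {R : realType} {d : nat} (M : 'M[int]_d).
Variables (p q : \bar R) (alpha gamma N s Ctphi Cphi : R) (b : 'cV[int]_d -> R).
Variables (phi : nat -> 'cV[R]_d -> R[i]) (tphi : nat -> periodic_distribution R d).
Hypotheses (d_gt0 : (0 < d)%N) (dM : dilation R M) (q_ge1 : (1 <= q)%E)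
  (pq : (p^-1 + q^-1 = 1)%E) (alpha_ge0 : 0 <= alpha) (N_ge0 : 0 <= N) (s_gt0 : 0 < s)
  (Lphi : forall j, (0 < j)%N -> Lp p (phi j))
  (growth : growth_condition M tphi N Ctphi) (strang : strang_fix M phi b s)
  (compat : weak_compatibility M phi tphi b s) (bounded : uniform_bound M phi Cphi)
  (b_ge0 : forall n, 0 <= b n)
  (b_fin : (wlnorm q alpha (fun n => (b n)%:C%C) < +oo)%E)
  (alpha_gamma : alpha < gamma)
  (gamma_gt : q != 1%E -> (N%:E + d%:R%:E * p^-1 < gamma%:E)%E)
  (gamma_ge : q = 1%E -> N <= gamma).

Let detM : \det M != 0 := dilation_det dM.

Lemma N_le_gamma : N <= gamma.
Proof.
have [/gamma_ge//|q1] := eqVneq q 1%E.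
have [x x0 px] := conj_exponent_inv_ge0 q_ge1 pq.
have := gamma_gt q1; rewrite px -EFinM -EFinD lte_fin => /ltW; apply: le_trans.
by rewrite lerDl mulr_ge0.
Qed.

Lemma quasi_error_bound : exists2 C : R, 0 <= C & forall j f, (0 < j)%N ->
  Aspace q gamma f ->
  [/\ forall k, csummable (pairing_term M j f (tphi j) k),
      Lp 1 (quasi_error M j f (phi j) (tphi j)) &
      (Anorm q alpha (quasi_error M j f (phi j) (tphi j)) <=
        (C * opnorm (adjpow R M j) `^ (2 * alpha) *
           opnorm (adjpowV R M j) `^ Num.min gamma (s + alpha))%:E * Anorm q gamma f)%E].
Proof.
have [C0 C0_ge0 C0P] := adjpowV_bounded dM.
have [||W W0 WP] := lattice_duality (delta := gamma - N) d_gt0 q_ge1 pq _ _.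
- move=> q1; have [x x0 px] := conj_exponent_inv_ge0 q_ge1 pq.
  have := gamma_gt q1; rewrite px -!EFinM -EFinD !lte_fin; lra.
- by move=> q1; rewrite subr_ge0 gamma_ge.
have detMj j : \det (M^T ^+ j) != 0 := detMTX j detM.
pose B n := theta alpha n * b n.
have B0 n : 0 <= B n by rewrite mulr_ge0 ?theta_ge0.
have finB : (lqnorm q B < +oo)%E.
  move: b_fin; rewrite wlnormE (_ : (fun n => _) = B)//.
  by apply/funext => n; rewrite normc_real ger0_norm.
have [c c0 cP] := lqnorm_assembly q_ge1 B0 finB.
pose K0 := error_cst alpha gamma s C0 N Ctphi Cphi b W.
(* The growth and boundedness constants are nonnegative because they bound moduli at the digit 0;
   level 1 supplies these bounds. *)
have K00 : 0 <= K0.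
  exact: (error_cst_ge0 (detMj 1%N) alpha gamma s C0 N b_ge0 (growth (ltn0Sn 0)).2
    (bounded (ltn0Sn 0)) W0).
exists (c * K0); first exact: mulr_ge0.
move=> j f j0 [Lf finf].
have [pf intf] := (Lp1P f).1 Lf.
have [pphi iphi] := (Lp1P (phi j)).1 (Lp_sub1 (conj_exponent_ge1 q_ge1 pq) (Lphi j0)).
rewrite /Anorm wlnormE in finf.
have scoef : csummable (pairing_coef f (tphi j)).
  exact: (csummable_lattice_coef d_gt0 (detMj j) N_ge0 N_le_gamma (growth j0).1 (growth j0).2
    q_ge1 WP finf).
have QP := fourier_quasi_projection j detM pphi iphi scoef.
have [pQ iQ _] := QP 0.
have intE : torus_integrable (fun x => f x + -1 * quasi_projection M j f (phi j) (tphi j) x).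
  by apply: torus_integrableD => //; exact: torus_integrableZ.
have errE : quasi_error M j f (phi j) (tphi j) =
    (fun x => f x + -1 * quasi_projection M j f (phi j) (tphi j) x).
  by apply/funext => x; rewrite mulN1r.
split.
- by move=> k; exact: csummable_pairing_term.
- by apply/Lp1P; split; rewrite errE// => x k; rewrite pf pQ.
rewrite /Anorm !wlnormE.
have rateE : rate (M^T ^+ j) alpha gamma s = opnorm (adjpow R M j) `^ (2 * alpha) *
  opnorm (adjpowV R M j) `^ Num.min gamma (s + alpha) by [].
rewrite -(mulrA (c * K0)) -rateE -(mulrA c).
have rate0 := @rate_ge0 R d (M^T ^+ j) alpha gamma s.
apply: (cP (M^T ^+ j)) => //.
- by move=> l; rewrite mulr_ge0 ?theta_ge0 ?normc_ge0.
- by move=> l; rewrite mulr_ge0 ?theta_ge0 ?normc_ge0.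
- exact: mulr_ge0.
move=> n r rD; have [_ _ Ql] := QP (M^T ^+ j *m n + r).
rewrite errE (fourierD _ intf (torus_integrableZ _ iQ)) (fourierZ _ _ iQ) Ql mulN1r.
exact: (lattice_error_bound d_gt0 (detMj j) (opnorm_zmat_ge1 d_gt0 (detMj j)) alpha_ge0 s_gt0
  alpha_gamma (C0P j) N_ge0 N_le_gamma b_ge0 (growth j0).1 (growth j0).2 (strang j0) (compat j0)
  (bounded j0) q_ge1 W0 WP finf n rD).
Qed.

End QuasiError.

(** With m = min(gamma, s + alpha), the powers of |lambda| combine to - j (m - 2 alpha). Here m >=
    0, so norm bounds may be raised to the power m, while m - 2 alpha may be negative. *)
Lemma isotropic_rate {R : realType} d (M : 'M[int]_d) (alpha gamma s : R) (lambda : R[i]) :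
  dilation R M -> isotropic R M -> eigenvalue (cmat R M) lambda ->
  0 <= alpha -> 0 < s -> alpha < gamma ->
  exists2 C : R, 0 <= C & forall j,
    opnorm (adjpow R M j) `^ (2 * alpha) * opnorm (adjpowV R M j) `^ Num.min gamma (s + alpha) <=
    C * normc lambda `^ (- (j%:R * Num.min (gamma - 2 * alpha) (s - alpha))).
Proof.
move=> dM iM eig a0 s0 ag; have [C [C0 CA CV]] := isotropic_opnorm dM iM eig.
have l1 : 1 < normc lambda by exact: dM.
have l0 : 0 < normc lambda by exact: lt_trans l1.
set m := Num.min gamma (s + alpha).
have m0 : 0 <= m by rewrite /m le_min; apply/andP; split; lra.
have mE : Num.min (gamma - 2 * alpha) (s - alpha) = m - 2 * alpha.
  by rewrite /m addr_minl; congr Num.min; ring.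
exists (C `^ (2 * alpha) * C `^ m); first by rewrite mulr_ge0 ?powR_ge0.
move=> j.
have -> : C `^ (2 * alpha) * C `^ m *
    normc lambda `^ (- (j%:R * Num.min (gamma - 2 * alpha) (s - alpha))) =
    (C * normc lambda ^+ j) `^ (2 * alpha) * (C * normc lambda ^- j) `^ m.
  have lj : normc lambda ^+ j = normc lambda `^ j%:R by rewrite powR_mulrn// ltW.
  have ljV : normc lambda ^- j = normc lambda `^ (- j%:R) by rewrite powRN -lj.
  rewrite ljV lj !powRM ?powR_ge0// -!powRrM mE.
  rewrite (_ : - (j%:R * (m - 2 * alpha)) = j%:R * (2 * alpha) + - j%:R * m); last by ring.
  by rewrite powRD ?(gt_eqF l0) ?implybT//; ring.
apply: ler_pM; rewrite ?powR_ge0//; apply: powR_le => //; try exact: opnorm_ge0.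
by rewrite mulr_ge0.
Qed.

(** The first conclusion gives the others their meaning: the pairings are absolutely convergent sums
    rather than default values of [csum], and the error is integrable, so its Fourier coefficients
    are genuine. *)
Theorem theorem6 (R : realType) (d : nat) (M : 'M[int]_d) (p q : \bar R)
  (alpha gamma N s Ctphi Cphi : R) (b : 'cV[int]_d -> R)
  (phi : nat -> 'cV[R]_d -> R[i]) (tphi : nat -> periodic_distribution R d) :
  (0 < d)%N ->
  dilation R M ->
  (1 <= q)%E -> (p^-1 + q^-1 = 1)%E ->
  0 <= alpha -> 0 <= N -> 0 < s ->
  (forall j, (0 < j)%N -> Lp p (phi j)) ->
  growth_condition M tphi N Ctphi ->
  strang_fix M phi b s ->
  weak_compatibility M phi tphi b s ->
  uniform_bound M phi Cphi ->
  (forall n, 0 <= b n) ->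
  (wlnorm q alpha (fun n => (b n)%:C%C) < +oo)%E ->
  alpha < gamma ->
  (q != 1%E -> (N%:E + d%:R%:E * p^-1 < gamma%:E)%E) ->
  (q = 1%E -> N <= gamma) ->
  [/\ forall (j : nat) (f : 'cV[R]_d -> R[i]), (0 < j)%N ->
        Aspace q gamma f ->
        (forall k, csummable (pairing_term M j f (tphi j) k)) /\
        Aspace q alpha (quasi_error M j f (phi j) (tphi j)),
      exists C : R, forall (j : nat) (f : 'cV[R]_d -> R[i]), (0 < j)%N ->
        Aspace q gamma f ->
        (Anorm q alpha (quasi_error M j f (phi j) (tphi j)) <=
           (C * opnorm (adjpow R M j) `^ (2 * alpha)
              * opnorm (adjpowV R M j) `^ Num.min gamma (s + alpha))%:E
           * Anorm q gamma f)%E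
    & isotropic R M -> forall lambda : R[i], eigenvalue (cmat R M) lambda ->
        exists C' : R, forall (j : nat) (f : 'cV[R]_d -> R[i]), (0 < j)%N ->
          Aspace q gamma f ->
          (Anorm q alpha (quasi_error M j f (phi j) (tphi j)) <=
             (C' * normc lambda `^
                (- (j%:R * Num.min (gamma - 2 * alpha) (s - alpha))))%:E
             * Anorm q gamma f)%E].
Proof.
move=> d0 dM q1 pq a0 N0 s0 Lphi growth strang compat bounded b0 bfin ag gamma_gt gamma_ge.
have [C C0 CP] := quasi_error_bound d0 dM q1 pq a0 N0 s0 Lphi growth strang compat bounded
  b0 bfin ag gamma_gt gamma_ge.
split.
- move=> j f j0 Af; have [sum L1 bnd] := CP j f j0 Af.
  split; [exact: sum|split; first exact: L1].
  apply: le_lt_trans bnd _; have [_ fin] := Af.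
  apply: lte_mul_pinfty => //; first by rewrite lee_fin !mulr_ge0 ?powR_ge0.
- by exists C => j f j0 Af; have [_ _] := CP j f j0 Af.
- move=> iM lambda eig.
  have [C' C'0 C'P] := isotropic_rate dM iM eig a0 s0 ag.
  exists (C * C') => j f j0 Af; have [_ _ bnd] := CP j f j0 Af.
  apply: le_trans bnd _; rewrite -!mulrA.
  apply: lee_wpmul2r; first by rewrite /Anorm wlnormE; apply: (lqnorm_ge0 0) => // k;
    rewrite mulr_ge0 ?theta_ge0 ?normc_ge0.
  by rewrite lee_fin ler_wpM2l.
Qed.
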